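(* Let $n\ge2$, $r\in\mathbb Z_n$, $\mathsf V=\mathsf V(2,r)$, $\lambda_r=q^{-r(r+1)}$ and $\xi=-(q^{1/2}+q^{-1/2})$. For $1\le k\le 2n-2$, the algebra homomorphism $\pi:\mathsf{TL}_k(\xi)\to\mathrm{End}_{\mathsf D_n}(\mathsf V^{\otimes k})$, $\pi(\mathsf t_i)=q^{1/2}(\lambda_r^{-1}\check{\mathsf R}_i-\mathrm{id})$, is an isomorphism.
   Context: $\mathbb k$ algebraically closed of characteristic zero, $n\ge2$, $q\in\mathbb k$ a primitive $n$th root of unity; fix a square root $q^{1/2}$ and put $q^{-1/2}=(q^{1/2})^{-1}$. $\mathsf D_n$ is the Hopf algebra generated by $a,b,c,d$ with relations $ba=qab$, $db=qbd$, $bc=cb$, $ca=qac$, $dc=qcd$, $da-qad=1-bc$, $a^n=d^n=0$, $b^n=c^n=1$ and $\Delta(a)=a\otimes b+1\otimes a$, $\Delta(d)=d\otimes c+1\otimes d$, $\Delta(b)=b\otimes b$, $\Delta(c)=c\otimes c$. For $1\le\ell\le n$, $s\in\mathbb Z_n$, $\mathsf V(\ell,s)$ is the module with basis $v_1,\dots,v_\ell$ and action $a.v_j=v_{j+1}$ ($j<\ell$), $a.v_\ell=0$, $b.v_j=q^{s+j-1}v_j$, $c.v_j=q^{j-(s+\ell)}v_j$, $d.v_1=0$, $d.v_j=\alpha_{j-1}(\ell)v_{j-1}$ ($j>1$), $\alpha_i(\ell)=\frac{(q^i-1)(1-q^{i-\ell})}{q-1}$. With $[m]=1+q+\dots+q^{m-1}$,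 $[m]!=[m]\cdots[1]$, $[0]!=1$, the R-matrix is $\mathcal R=\frac1n\sum_{m,s,t=0}^{n-1}\frac{q^{-tm}}{[s]!}a^sb^t\otimes c^md^s$. $\mathsf R$ is the action of $\mathcal R$ on $\mathsf V\otimes\mathsf V$ ($a^sb^t$ on the first factor), $\sigma$ the flip, $\check{\mathsf R}=\sigma\mathsf R$, and $\check{\mathsf R}_i=\mathrm{id}^{\otimes(i-1)}\otimes\check{\mathsf R}\otimes\mathrm{id}^{\otimes(k-i-1)}$ on $\mathsf V^{\otimes k}$. $\mathsf{TL}_k(\xi)$ is the $\mathbb k$-algebra with generators $\mathsf t_1,\dots,\mathsf t_{k-1}$ and relations $\mathsf t_i\mathsf t_j=\mathsf t_j\mathsf t_i$ ($|i-j|>1$), $\mathsf t_i\mathsf t_{i+1}\mathsf t_i-\mathsf t_i=\mathsf t_{i+1}\mathsf t_i\mathsf t_{i+1}-\mathsf t_{i+1}$ and $\mathsf t_i\mathsf t_{i+1}\mathsf t_i=\mathsf t_i$ ($1\le i\le k-2$), $\mathsf t_i^2=\xi\mathsf t_i$ ($1\le i\le k-1$); for $k=1$ it is $\mathbb k$ and $\pi$ is the unit map. *)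

(* Defs.v *)
From HB Require Import structures.
From mathcomp Require Import all_boot all_order all_algebra.

Set Implicit Arguments.
Unset Strict Implicit.
Unset Printing Implicit Defensive.

Import GRing.Theory.
Local Open Scope ring_scope.

Inductive gen := Ga | Gb | Gc | Gd.

Lemma ltn_pos0 (k : nat) (i : 'I_k.-1) : (i < k)%N.
Proof. case: k i => [[] //|k] [i hi] /=; exact: ltnW. Qed.

Lemma ltn_pos1 (k : nat) (i : 'I_k.-1) : (i.+1 < k)%N.
Proof. by case: k i => [[] //|k] [i hi]. Qed.

Definition pos0 (k : nat) (i : 'I_k.-1) : 'I_k := Ordinal (ltn_pos0 i).
Definition pos1 (k : nat) (i : 'I_k.-1) : 'I_k := Ordinal (ltn_pos1 i).

Section Dn.
Variable K : fieldType.
Variable q : K.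

Definition alpha (l i : nat) : K :=
  (q ^+ i - 1) * (1 - q ^ (i%:Z - l%:Z)) / (q - 1).

(* The module V(l,s): basis v_1..v_l is indexed by j : 'I_l (v_{j+1}).
   Matrix entry (i, j) = coefficient of v_{i+1} in g.v_{j+1}. *)
Definition Va (l : nat) : 'M[K]_l := \matrix_(i, j) ((i == j.+1 :> nat)%:R).
Definition Vb (l : nat) (s : int) : 'M[K]_l :=
  \matrix_(i, j) ((i == j)%:R * q ^ (s + (j : nat)%:Z)).
Definition Vc (l : nat) (s : int) : 'M[K]_l :=
  \matrix_(i, j) ((i == j)%:R * q ^ ((j : nat)%:Z + 1 - (s + l%:Z))).
Definition Vd (l : nat) : 'M[K]_l :=
  \matrix_(i, j) ((i.+1 == j :> nat)%:R * alpha l j).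

Definition Vact (l : nat) (s : int) (g : gen) : 'M[K]_l :=
  match g with Ga => Va l | Gb => Vb l s | Gc => Vc l s | Gd => Vd l end.

(* Tensor powers: basis of V^{(x)k} indexed by functions 'I_k -> 'I_l;
   operators are given by their matrix entries (output, input). *)
Definition tpb (l k : nat) := {ffun 'I_k -> 'I_l}.
Definition op (l k : nat) := tpb l k -> tpb l k -> K.

Definition opid (l k : nat) : op l k := fun x y => (x == y)%:R.
Definition opmul (l k : nat) (M N : op l k) : op l k :=
  fun x y => \sum_(z : tpb l k) M x z * N z y.

Definition thead (l k : nat) (x : tpb l k.+1) : 'I_l := x ord0.
Definition ttail (l k : nat) (x : tpb l k.+1) : tpb l k :=
  [ffun i => x (lift ord0 i)].
Definition tens (l k : nat) (A : 'M[K]_l) (M : op l k) : op l k.+1 :=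
  fun x y => A (thead x) (thead y) * M (ttail x) (ttail y).

Definition counit (g : gen) : K :=
  match g with Gb | Gc => 1 | _ => 0 end.

(* Action of the generators on V^{(x)k} through the (iterated) coproduct
   Delta(a) = a(x)b + 1(x)a, Delta(d) = d(x)c + 1(x)d,
   Delta(b) = b(x)b, Delta(c) = c(x)c. *)
Fixpoint rho (l : nat) (act : gen -> 'M[K]_l) (k : nat) : gen -> op l k :=
  match k return gen -> op l k with
  | 0 => fun g _ _ => counit g
  | k'.+1 => fun g =>
    match g with
    | Ga => fun x y => tens (act Ga) (@rho l act k' Gb) x y
                       + tens 1%:M (@rho l act k' Ga) x y
    | Gb => tens (act Gb) (@rho l act k' Gb)
    | Gc => tens (act Gc) (@rho l act k' Gc)
    | Gd => fun x y => tens (act Gd) (@rho l act k' Gc) x y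
                       + tens 1%:M (@rho l act k' Gd) x y
    end
  end.

(* End_{D_n}(V^{(x)k}): operators commuting with the action of D_n
   (equivalently, of its generators a, b, c, d). *)
Definition commutant (l k : nat) (G : gen -> op l k) (M : op l k) : Prop :=
  forall g x y, opmul M (G g) x y = opmul (G g) M x y.

Definition qint (m : nat) : K := \sum_(i < m) q ^+ i.
Definition qfact (m : nat) : K := \prod_(i < m) qint i.+1.

Definition Rmat (n l : nat) (act : gen -> 'M[K]_l) (x1 x2 y1 y2 : 'I_l) : K :=
  n%:R^-1 * \sum_(m < n) \sum_(s < n) \sum_(t < n)
    (q ^- (t * m) / qfact s *
     ((act Ga ^+ s *m act Gb ^+ t) x1 y1 * (act Gc ^+ m *m act Gd ^+ s) x2 y2)).

Definition Rcheck (n l : nat) (act : gen -> 'M[K]_l) (x1 x2 y1 y2 : 'I_l) : K :=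
  Rmat n act x2 x1 y1 y2.

(* Rcheck_i on V^{(x)k}, acting on the factors i and i+1
   (i : 'I_k.-1 is 0-based, i.e. it stands for the paper's index i+1). *)
Definition Rcheck_i (n l k : nat) (act : gen -> 'M[K]_l) (i : 'I_k.-1) : op l k :=
  fun x y => Rcheck n act (x (pos0 i)) (x (pos1 i)) (y (pos0 i)) (y (pos1 i))
             * \prod_(j : 'I_k | (j != pos0 i) && (j != pos1 i)) (x j == y j)%:R.

Definition piT (n l k : nat) (act : gen -> 'M[K]_l) (qh lam : K) (i : 'I_k.-1)
  : op l k :=
  fun x y => qh * (lam^-1 * Rcheck_i n act i x y - opid x y).

(* ---------------- Temperley-Lieb algebra TL_k(xi) ---------------------
   TL_k(xi) = free algebra on t_1..t_{k-1} modulo the two-sided ideal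
   generated by the defining relations.  Elements of the free algebra are
   represented by finite formal sums of words (generator t_{i+1} is i). *)
Definition word (k : nat) := seq 'I_k.-1.
Definition ncpoly (k : nat) := seq (K * word k).

(* coefficient of a word in a formal sum: two ncpolys represent the same
   element of the free algebra iff all their coefficients agree *)
Definition coef (k : nat) (p : ncpoly k) (w : word k) : K :=
  \sum_(x <- p) (if x.2 == w then x.1 else 0).

Definition rel_comm (k : nat) (i j : 'I_k.-1) : ncpoly k :=
  [:: (1, [:: i; j]); (-1, [:: j; i])].
Definition rel_braidA (k : nat) (i i' : 'I_k.-1) : ncpoly k :=
  [:: (1, [:: i; i'; i]); (-1, [:: i]); (-1, [:: i'; i; i']); (1, [:: i'])].
Definition rel_braidB (k : nat) (i i' : 'I_k.-1) : ncpoly k :=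
  [:: (1, [:: i; i'; i]); (-1, [:: i])].
Definition rel_quad (k : nat) (xi : K) (i : 'I_k.-1) : ncpoly k :=
  [:: (1, [:: i; i]); (- xi, [:: i])].

Definition is_TLrel (k : nat) (xi : K) (p : ncpoly k) : Prop :=
  (exists i j : 'I_k.-1, ((i.+1 < j)%N \/ (j.+1 < i)%N) /\ p = rel_comm i j)
  \/ (exists i i' : 'I_k.-1, (i' : nat) = i.+1 /\
                             (p = rel_braidA i i' \/ p = rel_braidB i i'))
  \/ (exists i : 'I_k.-1, p = rel_quad xi i).

Definition sandwich (k : nat) (c : K) (u : word k) (rel : ncpoly k) (v : word k)
  : ncpoly k := [seq (c * x.1, u ++ x.2 ++ v) | x <- rel].

Definition in_TLideal (k : nat) (xi : K) (p : ncpoly k) : Prop :=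
  exists gens : seq (K * word k * ncpoly k * word k),
    (forall g, g \in gens -> is_TLrel xi g.1.2) /\
    forall w, coef p w =
      coef (flatten [seq sandwich g.1.1.1 g.1.1.2 g.1.2 g.2 | g <- gens]) w.

Definition evword (l k : nat) (T : 'I_k.-1 -> op l k) (w : word k) : op l k :=
  foldr (fun i M => opmul (T i) M) (@opid l k) w.
Definition evpoly (l k : nat) (T : 'I_k.-1 -> op l k) (p : ncpoly k) : op l k :=
  fun x y => \sum_(t <- p) t.1 * evword T t.2 x y.

(* The assignment t_i |-> T_i defines an algebra isomorphism
   TL_k(xi) -> End_{D_n}(V^{(x)k}) :
   - each T_i lies in End_{D_n}(V^{(x)k});
   - the relators vanish (so the homomorphism is well defined);
   - it is surjective onto End_{D_n}(V^{(x)k});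
   - it is injective: its kernel on the free algebra is exactly the ideal. *)
Definition TL_iso (l k : nat) (xi : K) (G : gen -> op l k)
  (T : 'I_k.-1 -> op l k) : Prop :=
  [/\ forall i, commutant G (T i),
      forall p, is_TLrel xi p -> forall x y, evpoly T p x y = 0,
      forall M, commutant G M -> exists p, forall x y, evpoly T p x y = M x y
    & forall p, (forall x y, evpoly T p x y = 0) -> in_TLideal xi p].

End Dn.

(* Main.v *)
Require Import Defs.
From HB Require Import structures.
From mathcomp Require Import all_boot all_order all_algebra.
From mathcomp Require Import ring zify.
Import GRing.Theory.
Local Open Scope ring_scope.

(** Write true for v_2 and false for v_1, so that the basis of the tensor power
    is indexed by words of length k.

    Surjectivity.  Let M commute with a, b, c, d and consider its block from
    weight j to weight i (the weight counts the letters true).  Commutation with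
    b forces i = j mod n.  If all blocks of higher weight vanish, the columns of
    the block lie in ker a and its rows in the kernel of the transpose of d.  Such
    a vector is determined by its coefficients on ballot words: split off the
    first letter and induct; the only quantum integers [m] to invert have m < n
    because k <= 2n - 2.  When i <> j one of the two weights carries no ballot
    word, so the block is 0; hence M is determined by its entries at the pairs of
    ballot words of equal weight.

    Injectivity.  Modulo the Temperley-Lieb relations every word is a multiple of
    a normal word u e_h v^op, where e_h = t_1 t_3 ... t_(2h-1) and u, v encode
    lattice paths (upper and lower halves of a diagram), that is, a pair of ballot
    words of equal weight.  The matrix of a normal word is supported on the pairs
    dominated by its own, with nonzero entry there.  By triangularity the normal
    words are linearly independent, and every M as above is a combination of them. *)

Set Implicit Arguments.
Unset Strict Implicit.
Unset Printing Implicit Defensive.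

(** * The operators on words *)

Notation ups w := (count id w).

Section Operators.
Variable K : fieldType.
Variables q theta g : K.
Implicit Types (f : seq bool -> K) (w : seq bool).

(* With (theta, g) = (q^r, 1) this is the action of a on vectors; with
   (theta, g) = (q^(-1-r), 1 - q^-1) it is the action of d on row vectors.  In the
   same way tlop below is t_(i+1) acting on columns (theta = q^r) and on rows
   (theta = q^(-1-r)), so each property of t_(i+1) is proved once for both. *)
Fixpoint raise f w : K :=
  match w with
  | [::] => 0
  | false :: w' => raise (fun v => f (false :: v)) w'
  | true :: w' => raise (fun v => f (true :: v)) w'
                  + g * theta ^+ size w' * q ^+ ups w' * f (false :: w')
  end.

Lemma raise_ext_ups f f' w :
  (forall v, size v = size w -> (ups v).+1 = ups w -> f v = f' v) ->
  raise f w = raise f' w.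
Proof.
elim: w f f' => //= -[] w IH f f' H; last first.
  by apply: IH => v Hv Hu; apply: H; rewrite /= ?Hv.
congr (_ + _ * _); last exact: H.
by apply: IH => v Hv Hu; apply: H; rewrite /= ?Hv // !add1n Hu.
Qed.

Lemma raise_ext f f' w :
  (forall v, size v = size w -> f v = f' v) -> raise f w = raise f' w.
Proof. by move=> H; apply: raise_ext_ups => v /H. Qed.

Lemma raise_true f w :
  raise f (true :: w) = raise (fun v => f (true :: v)) w
                        + g * theta ^+ size w * q ^+ ups w * f (false :: w).
Proof. by []. Qed.

Lemma raise_lin c f f' w :
  raise (fun v => f v + c * f' v) w = raise f w + c * raise f' w.
Proof.
elim: w f f' => [|[] w IH] f f' /=; first by rewrite mulr0 addr0.
  by rewrite IH; ring.
exact: IH.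
Qed.

Lemma raise0 f w : (forall v, size v = size w -> f v = 0) -> raise f w = 0.
Proof.
elim: w f => //= -[] w IH f H; last by apply: IH => v Hv; apply: H; rewrite /= Hv.
by rewrite H // mulr0 addr0; apply: IH => v Hv; apply: H; rewrite /= Hv.
Qed.

Lemma raise_supp f w j :
  (forall v, size v = size w -> ups v <> j -> f v = 0) ->
  ups w <> j.+1 -> raise f w = 0.
Proof.
elim: w f j => //= -[] w IH f j H /= Hj; last first.
  by apply: (IH _ j) => // v Hv Hj'; apply: H; rewrite /= ?Hv.
rewrite (H (false :: w)) ?mulr0 ?addr0 //=; last by lia.
case: j H Hj => [|j] H Hj.
  by apply: raise0 => v Hv; apply: H; rewrite /= ?Hv.
apply: (IH _ j) => [v Hv Hj'|]; last by lia.
by apply: H => /=; rewrite ?Hv //; lia.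
Qed.

Lemma iter_raise0 m f w :
  (forall v, size v = size w -> f v = 0) -> iter m raise f w = 0.
Proof.
elim: m w => [|m IH] w H /=; first exact: H.
by apply: raise0 => v Hv; apply: IH => u Hu; apply: H; rewrite Hu.
Qed.

Lemma iter_raise_supp m f w j :
  (forall v, size v = size w -> ups v <> j -> f v = 0) ->
  ups w <> (j + m)%N -> iter m raise f w = 0.
Proof.
elim: m w => [|m IH] w H /=; first by rewrite addn0; exact: H.
rewrite addnS; apply: raise_supp => v Hv; apply: IH => u Hu; apply: H.
by rewrite Hu.
Qed.

Lemma iter_raise_false m f w :
  iter m raise f (false :: w) = iter m raise (fun v => f (false :: v)) w.
Proof.
elim: m w => //= m IH w.
by apply: raise_ext => v _; rewrite IH.
Qed.

(** The first letter is raised at most once, at one of m + 1 moments. After i raisings of the tail,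
    which starts at weight j, that step costs a factor [q ^+ (j + i)]; summing over i gives [q ^+ j]
    times [m+1]. *)
Lemma iter_raise_true m j f w :
  (forall v, size v = size w -> ups v <> j -> f (false :: v) = 0) ->
  iter m.+1 raise f (true :: w) =
    iter m.+1 raise (fun v => f (true :: v)) w
    + g * theta ^+ size w * q ^+ j * qint q m.+1
      * iter m raise (fun v => f (false :: v)) w.
Proof.
elim: m w => [|m IH] w H.
  rewrite /= /qint big_ord1 expr0 mulr1; congr (_ + _).
  have [->//|/eqP Hj] := eqVneq (ups w) j.
  by rewrite H // !mulr0.
have E v : size v = size w -> iter m.+1 raise f (true :: v) =
    iter m.+1 raise (fun u => f (true :: u)) v
    + g * theta ^+ size w * q ^+ j * qint q m.+1
      * iter m raise (fun u => f (false :: u)) v.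
  by move=> Hv; rewrite IH Hv // => u ?; apply: H; congruence.
rewrite [iter m.+2 _ _]iterS raise_true (raise_ext E) raise_lin iter_raise_false -!iterS.
have [->|/eqP Hj] := eqVneq (ups w) (j + m.+1)%N; last first.
  by rewrite (iter_raise_supp (w := w) H Hj); ring.
by rewrite /qint (big_ord_recr m.+1) /= exprD; ring.
Qed.

(** * Ballot words and kernels of powers of [raise] *)

Fixpoint ballot (s : nat) w : bool :=
  match w with
  | [::] => true
  | true :: w' => ballot s.+1 w'
  | false :: w' => (0 < s)%N && ballot s.-1 w'
  end.

Lemma ballot_size s w : ballot s w -> (size w <= s + 2 * ups w)%N.
Proof.
elim: w s => //= -[] w IH s; first by move/IH; rewrite /=; lia.
by case/andP => H /IH /=; lia.
Qed.

Lemma qint_neq0 n m :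
  n.-primitive_root q -> (0 < m < n)%N -> qint q m != 0.
Proof.
move=> Hq /andP[m0 mn]; apply/eqP => H.
have: q ^+ m - 1 = 0 by rewrite subrX1 -/(qint q m) H mulr0.
move/eqP; rewrite subr_eq0 -(prim_order_dvd Hq) => /dvdn_leq; lia.
Qed.

Lemma primitive_root_neq0 n : n.-primitive_root q -> q != 0.
Proof.
move=> Hq; apply/eqP => q0; have := prim_expr_order Hq.
rewrite q0 expr0n eqn0Ngt (prim_order_gt0 Hq) => /eqP.
by rewrite eq_sym oner_eq0.
Qed.

Lemma primitive_root_neq1 n : (2 <= n)%N -> n.-primitive_root q -> q != 1.
Proof.
move=> Hn Hq; apply: contraTneq Hn => q1.
by have := prim_order_dvd Hq 1; rewrite q1 expr1n eqxx dvdn1 => /eqP ->.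
Qed.

(* In the split f = v1 (x) f0 + v2 (x) f1, the equation raise^(s+1) f = 0 forces
   raise^(s+2) f1 = 0 and then [s+1] raise^s f0 = 0.  The alternative on n
   says that [s+1] is invertible unless raise^s f0 vanishes by weight. *)
Lemma ballot_determines n N s j f :
    n.-primitive_root q -> theta != 0 -> g != 0 ->
    (forall w, size w = N -> ups w <> j -> f w = 0) ->
    (forall w, size w = N -> iter s.+1 raise f w = 0) ->
    (N < n + j)%N || (j + s.+1 < n)%N ->
    (forall w, size w = N -> ballot s w -> f w = 0) ->
  forall w, size w = N -> f w = 0.
Proof.
move=> Hq th0 g0; elim: N s j f => [|N IH] s j f Hj Hr Hn Hb w Hw.
  by apply: Hb; rewrite // (size0nil Hw).
have q0 := primitive_root_neq0 Hq.
have F1 v : size v = N -> f (true :: v) = 0.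
  case: j Hj Hn => [|j] Hj Hn Hv; first by apply: Hj; rewrite /= ?Hv.
  apply: (IH s.+1 j (fun v => f (true :: v))) Hv => //.
  - by move=> u Hu Hju; apply: Hj; rewrite /= ?Hu //; lia.
  - move=> u Hu; have := @iter_raise_true s.+1 j.+1 f u.
    rewrite [LHS]raise0; last by move=> x Hx; apply: Hr; rewrite Hx /= Hu.
    rewrite [X in _ + _ * X](_ : _ = 0) => [|].
      rewrite mulr0 addr0 => <- // x Hx Hju.
      by apply: Hj => //=; rewrite Hx Hu.
    by rewrite -iter_raise_false; apply: Hr; rewrite /= Hu.
  - by lia.
  - by move=> u Hu Hbu; apply: Hb; rewrite /= ?Hu.
have F0 v : size v = N -> iter s raise (fun v => f (false :: v)) v = 0.
  move=> Hv.
  have Hj' u : size u = size v -> ups u <> j -> f (false :: u) = 0.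
    by move=> Hu Hju; apply: Hj => //=; rewrite Hu Hv.
  have [Hs|Hs] := ltnP s.+1 n; last first.
    apply: (iter_raise_supp (w := v) Hj').
    by have := count_size id v; lia.
  have := iter_raise_true s Hj'; rewrite Hr /= ?Hv //.
  rewrite -iterS iter_raise0 => [/eqP|u Hu]; last by apply: F1; rewrite Hu.
  rewrite add0r eq_sym !mulf_eq0 (negbTE g0) !expf_eq0 (negbTE th0) (negbTE q0).
  by rewrite !andbF (negbTE (qint_neq0 Hq _)) ?Hs //= => /eqP.
case: w Hw => // -[] w [Hw]; first exact: F1.
(* At height 0 no ballot word begins with false, but there [F0] involves the zeroth power of [raise]
   and already reads f0 = 0. *)
case: s Hr Hb F0 Hn => [|s] Hr Hb F0 Hn; first exact: (F0 w).
apply: (IH s j (fun v => f (false :: v))) Hw => //.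
- by move=> u Hu Hju; apply: Hj; rewrite /= ?Hu.
- by lia.
- by move=> u Hu Hbu; apply: Hb; rewrite /= ?Hu.
Qed.

(** * Temperley-Lieb generators as operators on functions of words *)

Variable h : K.

Fixpoint tlop (i : nat) f w : K :=
  match i, w with
  | 0, a :: b :: v =>
      if a == b then 0
      else if a then h * (theta * f (b :: a :: v) - f w)
           else h^-1 * (theta^-1 * f (b :: a :: v) - f w)
  | i'.+1, a :: v => tlop i' (fun u => f (a :: u)) v
  | _, _ => 0
  end.

Lemma tlop_ext i f f' w :
  (forall v, size v = size w -> ups v = ups w -> f v = f' v) ->
  tlop i f w = tlop i f' w.
Proof.
elim: i f f' w => [|i IH] f f' [|a w] //= H; last first.
  by apply: IH => v Hv Huv; apply: H; rewrite /= ?Hv ?Huv.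
case: w H => [|b w] //= H.
by rewrite !H //= addnCA.
Qed.

Lemma tlop_lin i c f f' w :
  tlop i (fun v => f v + c * f' v) w = tlop i f w + c * tlop i f' w.
Proof.
elim: i f f' w => [|i IH] f f' [|a w] //=; rewrite ?mulr0 ?addr0 //.
case: w => [|b w] //=; rewrite ?mulr0 ?addr0 //.
by case: a; case: b => /=; ring.
Qed.

(** Exchanging two letters keeps length and weight. This yields commutation with b and c, and lets
    the coefficient of a first letter true pass through in [raise_tlop]. *)
Lemma tlop_weight i (F : nat -> nat -> K) f w :
  tlop i (fun v => F (size v) (ups v) * f v) w = F (size w) (ups w) * tlop i f w.
Proof.
rewrite -[RHS]add0r -[X in X + _]/((fun=> 0) w).
have -> : tlop i (fun v => F (size v) (ups v) * f v) w =
          tlop i (fun v => 0 + F (size w) (ups w) * f v) w.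
  by apply: tlop_ext => v -> ->; rewrite add0r.
rewrite tlop_lin; congr (_ + _).
by elim: i w {f} => [|i IH] [|a [|b w]] //=; rewrite ?mulr0 ?subr0 ?mulr0 ?if_same.
Qed.

Lemma tlop0 i f w :
  (forall v, size v = size w -> ups v = ups w -> f v = 0) -> tlop i f w = 0.
Proof.
move=> H; rewrite (tlop_ext _ (f' := fun v => 0 * f v)).
  by rewrite (tlop_weight i (fun _ _ => 0)) mul0r.
by move=> v Hv Hu; rewrite H // mul0r.
Qed.

Lemma tlop_cat P f w :
  tlop (size P) f (P ++ w) = tlop 0 (fun v => f (P ++ v)) w.
Proof. by elim: P f => //= a P IH f; rewrite IH. Qed.

Hypotheses (h0 : h != 0) (th0 : theta != 0) (hh : h ^+ 2 = q).

(** At the head of the word this is a computation with two letters, where [h ^+ 2 = q] enters.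
    Further right, a first letter true adds a term whose coefficient depends only on the length and
    weight of the tail, and [tlop] preserves both. *)
Lemma raise_tlop i f w : raise (tlop i f) w = tlop i (raise f) w.
Proof.
elim: i f w => [|i IH] f [|a w] //=.
  case: w => [|b w].
    by case: a => //=; rewrite mulr0 addr0.
  have R c c' : raise (fun v => c * f (false :: true :: v) + c' * f (true :: false :: v)) w
      = c * raise (fun v => f (false :: true :: v)) w
      + c' * raise (fun v => f (true :: false :: v)) w.
    rewrite raise_lin; congr (_ + _).
    rewrite -[RHS]add0r -[in RHS](raise0 (f := fun=> 0) (w := w)) // -raise_lin.
    by apply: raise_ext => v _; rewrite add0r.
  have R1 : raise (fun v => h * (theta * f (false :: true :: v) - f (true :: false :: v))) w
     = h * theta * raise (fun v => f (false :: true :: v)) w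
       - h * raise (fun v => f (true :: false :: v)) w.
    by rewrite -mulNr -R; apply: raise_ext => v _; ring.
  have R2 : raise (fun v => h^-1 * (theta^-1 * f (true :: false :: v) - f (false :: true :: v))) w
     = - h^-1 * raise (fun v => f (false :: true :: v)) w
       + h^-1 * theta^-1 * raise (fun v => f (true :: false :: v)) w.
    by rewrite -R; apply: raise_ext => v _; ring.
  have R0 : raise (fun=> 0) w = 0 by apply: raise0.
  by case: a; case: b; rewrite /= ?R1 ?R2 ?R0 -?hh ?add0n ?add1n ?exprS //=; field; rewrite ?h0 ?th0.
case: a => /=; rewrite IH //.
rewrite [RHS](tlop_ext i (f' := fun v => raise (fun u => f (true :: u)) v
   + 1 * (g * theta ^+ size v * q ^+ ups v * f (false :: v)))).
  by rewrite tlop_lin mul1r (tlop_weight _ (fun m n => g * theta ^+ m * q ^+ n)).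
by move=> v _ _; rewrite mul1r.
Qed.

(** On the two mixed words the matrix has determinant 0 and trace [- (h + h^-1)], so this is
    Cayley-Hamilton. *)
Lemma tlop_sq i f w : tlop i (tlop i f) w = - (h + h^-1) * tlop i f w.
Proof.
elim: i f w => [|i IH] f [|a w] //=; rewrite ?mulr0 //.
case: w => [|b w] /=; rewrite ?mulr0 //.
by case: a b => -[] /=; rewrite ?mulr0 //; field; rewrite ?h0 ?th0.
Qed.

Lemma tlop_comm i j f w :
  (i.+1 < j)%N -> tlop i (tlop j f) w = tlop j (tlop i f) w.
Proof.
elim: i j f w => [|i IH] [|j] f [|a w] //=; last exact: IH.
case: j => //= j _; case: w => //= b w.
pose P c d v := f (c :: d :: v).
case: a b => -[] /=.
- by rewrite tlop0.
- transitivity (tlop j (fun v => h * theta * P false true v + - h * P true false v) w).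
    rewrite tlop_lin (tlop_weight _ (fun _ _ => h * theta)) /P; ring.
  by apply: tlop_ext => v _ _; rewrite /P; ring.
- transitivity (tlop j (fun v => h^-1 * theta^-1 * P true false v + - h^-1 * P false true v) w).
    rewrite tlop_lin (tlop_weight _ (fun _ _ => h^-1 * theta^-1)) /P; ring.
  by apply: tlop_ext => v _ _; rewrite /P; ring.
- by rewrite tlop0.
Qed.

(** The length matters: beyond the end of the word [tlop] is 0, so on a shorter word the left side
    would vanish while the right side need not. *)
Lemma tlop_braid1 i f w : (i.+2 < size w)%N ->
  tlop i (tlop i.+1 (tlop i f)) w = tlop i f w.
Proof.
elim: i f w => [|i IH] f [|a w] //=; last exact: IH.
case: w => [|b [|c w]] // _.
by case: a; case: b; case: c => /=; rewrite ?mulr0 ?subr0 ?mulr0 //; field; rewrite ?h0 ?th0.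
Qed.

Lemma tlop_braid2 i f w : (i.+2 < size w)%N ->
  tlop i.+1 (tlop i (tlop i.+1 f)) w = tlop i.+1 f w.
Proof.
elim: i f w => [|i IH] f [|a w] //; last first.
  by rewrite ltnS => H; exact: (IH (fun u => f (a :: u)) w H).
case: w => [|b [|c w]] // _.
by case: a; case: b; case: c => /=; rewrite ?mulr0 ?subr0 ?mulr0 //; field; rewrite ?h0 ?th0.
Qed.

End Operators.

(** * Normal words in the Temperley-Lieb algebra *)

Section TLWords.
Variables (K : fieldType) (xi : K) (m : nat).
Implicit Types (a b u v : seq nat) (P Q R S T : seq bool).

(* [tlred u c v]: the word u equals c times the word v in the algebra
   TL_(m+1)(xi), the letter i < m standing for t_(i+1). *)
Inductive tlred : seq nat -> K -> seq nat -> Prop :=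
| tlred_refl u : tlred u 1 u
| tlred_trans u c v c' w : tlred u c v -> tlred v c' w -> tlred u (c * c') w
| tlred_sym u v : tlred u 1 v -> tlred v 1 u
| tlred_ctx a b u c v : tlred u c v -> tlred (a ++ u ++ b) c (a ++ v ++ b)
| tlred_comm i j : (i.+1 < j < m)%N -> tlred [:: i; j] 1 [:: j; i]
| tlred_sq i : (i < m)%N -> tlred [:: i; i] xi [:: i]
| tlred_braid1 i : (i.+1 < m)%N -> tlred [:: i; i.+1; i] 1 [:: i]
| tlred_braid2 i : (i.+1 < m)%N -> tlred [:: i.+1; i; i.+1] 1 [:: i.+1].

Local Notation "u ~~> v" := (tlred u 1 v) (at level 70).

(** Coefficient 1 gives an equivalence relation on words. A general coefficient cannot be inverted,
    since xi may be 0, as happens for q = -1. *)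
Lemma teq_trans v u w : u ~~> v -> v ~~> w -> u ~~> w.
Proof. by move=> H /(tlred_trans H); rewrite mulr1. Qed.

Lemma teq_tlred v u c w : u ~~> v -> tlred v c w -> tlred u c w.
Proof. by move=> H /(tlred_trans H); rewrite mul1r. Qed.

Lemma tlred_teq v u c w : tlred u c v -> v ~~> w -> tlred u c w.
Proof. by move=> H /(tlred_trans H); rewrite mulr1. Qed.

Lemma tlred_catl a u c v : tlred u c v -> tlred (a ++ u) c (a ++ v).
Proof. by move/(tlred_ctx a [::]); rewrite !cats0. Qed.

Lemma tlred_catr b u c v : tlred u c v -> tlred (u ++ b) c (v ++ b).
Proof. exact: (tlred_ctx [::] b). Qed.

(** The relations are stable under reversal, the flip of diagrams. Results on upper halves thereby
    transfer to lower halves. *)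
Lemma tlred_rev u c v : tlred u c v -> tlred (rev u) c (rev v).
Proof.
elim=> {u c v} [u|u c v c' w _ H1 _ H2|u v _ H|a b u c v _ H|i j H|i H|i H|i H].
- exact: tlred_refl.
- exact: tlred_trans H1 H2.
- exact: tlred_sym.
- by rewrite !rev_cat -!catA; apply: tlred_ctx.
- by apply: tlred_sym; exact: tlred_comm.
- exact: tlred_sq.
- exact: tlred_braid1.
- exact: tlred_braid2.
Qed.

Definition far (i j : nat) := (i.+1 < j)%N || (j.+1 < i)%N.

Lemma teq_far i j u : (i < m)%N -> (j < m)%N -> far i j ->
  i :: j :: u ~~> j :: i :: u.
Proof.
move=> Hi Hj /orP[H|H]; apply: (tlred_catr u (u := [:: _; _]) (v := [:: _; _])).
  by apply: tlred_comm; rewrite H.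
by apply: tlred_sym; apply: tlred_comm; rewrite H.
Qed.

Lemma teq_move i u : (i < m)%N -> all (fun j => (j < m)%N && far i j) u ->
  i :: u ~~> u ++ [:: i].
Proof.
move=> Hi; elim: u => [|j u IH] /=; first by move=> _; exact: tlred_refl.
case/andP => /andP[Hj Hf] /IH H.
apply: teq_trans (teq_far u Hi Hj Hf) _.
exact: (tlred_catl [:: j] H).
Qed.

Lemma teq_move_cat a u : all (fun i => i < m)%N a ->
  all (fun i => all (fun j => (j < m)%N && far i j) u) a -> a ++ u ~~> u ++ a.
Proof.
elim: a => [|i a IH] /=; first by rewrite cats0 => _ _; exact: tlred_refl.
case/andP => Hi Ha /andP[Hiu /(IH Ha) H].
apply: teq_trans (tlred_catl [:: i] H) _.
by have := tlred_catr a (teq_move Hi Hiu); rewrite -catA.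
Qed.

Fixpoint cups (h : nat) : seq nat :=
  if h is h'.+1 then rcons (cups h') h'.*2 else [::].

Lemma cups_bound h : all (fun j => j.+1 < h.*2)%N (cups h).
Proof.
elim: h => //= h IH; rewrite all_rcons doubleS ltnSn /=.
by apply: sub_all IH => j; lia.
Qed.

Lemma teq_rcons_cups h : (h.+1.*2 <= m.+1)%N ->
  rcons (cups h) h.*2 ~~> h.*2 :: cups h.
Proof.
move=> H; rewrite -cats1; apply: tlred_sym; apply: teq_move; first by lia.
by apply: sub_all (cups_bound h) => j; rewrite /far; lia.
Qed.

Lemma teq_rev_cups h : (h.*2 <= m.+1)%N -> rev (cups h) ~~> cups h.
Proof.
elim: h => [|h IH] H; first exact: tlred_refl.
rewrite /= rev_rcons; apply: teq_trans (tlred_sym (teq_rcons_cups H)).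
by apply: (tlred_catl [:: _]); apply: IH; lia.
Qed.

Lemma cups_front h j : (j < h)%N -> (h.*2 <= m.+1)%N ->
  exists v, cups h ~~> j.*2 :: v.
Proof.
elim: h => // h IH Hj H; case: (ltnP j h) => Hjh.
  have [|v Hv] := IH Hjh; first by lia.
  by exists (rcons v h.*2); rewrite /= -!cats1; apply: tlred_catr Hv.
have -> : j = h by lia.
by exists (cups h); exact: teq_rcons_cups.
Qed.

(** * Lattice paths, their peaks and their boxes *)

Fixpoint height (s : nat) S : nat :=
  match S with
  | [::] => s
  | true :: S' => height s.+1 S'
  | false :: S' => height s.-1 S'
  end.

Lemma height_cat s P Q : height s (P ++ Q) = height (height s P) Q.
Proof. by elim: P s => //= -[]. Qed.

Lemma height_nseq s p : height s (nseq p true) = (s + p)%N.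
Proof. by elim: p s => [|p IH] s /=; rewrite ?addn0 // IH addnS. Qed.

Lemma ballot_cat s P Q : ballot s (P ++ Q) = ballot s P && ballot (height s P) Q.
Proof. by elim: P s => //= -[] P IH s; rewrite IH ?andbA. Qed.

Lemma height_peak s P Q : height s (P ++ true :: false :: Q) = height s (P ++ Q).
Proof. by rewrite !height_cat. Qed.

(** Since [height] truncates at 0, a down step from the ground followed by an up step would end at
    height 1; the hypothesis excludes this. *)
Lemma height_valley s P Q : (0 < height s P)%N ->
  height s (P ++ false :: true :: Q) = height s (P ++ Q).
Proof. by rewrite !height_cat /= => /prednK ->. Qed.

(** The two paths differ in a single vertex, one above or one below the end of P. *)
Lemma ballot_valley s P Q : ballot s (P ++ false :: true :: Q) =
  (0 < height s P)%N && ballot s (P ++ true :: false :: Q).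
Proof.
rewrite !ballot_cat /=; case: (posnP (height s P)) => [->|H] /=.
  by rewrite andbF.
by rewrite prednK.
Qed.

Lemma two_peaks P Q P' Q' :
  P ++ true :: false :: Q = P' ++ true :: false :: Q' -> (size P < size P')%N ->
  exists R, P' = P ++ true :: false :: R /\ Q = R ++ true :: false :: Q'.
Proof.
elim: P P' => [|x P IH] [|y P'] //=; last first.
  by case=> -> /IH H /H [R [-> ->]]; exists R.
by case: P' => [|z R] [] // <- <- -> _; exists R.
Qed.

Definition zigzag h p := flatten (nseq h [:: true; false]) ++ nseq p true.

Lemma size_zigzag h p : size (zigzag h p) = (h.*2 + p)%N.
Proof. by elim: h => [|h IH]; rewrite /= ?size_nseq // IH doubleS. Qed.

Lemma ballot_zigzag h p s : ballot s (zigzag h p).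
Proof. by elim: h => //; elim: p s => //= p IH s; exact: IH. Qed.

(** Peaks of a zigzag stand on the starting level, so none is a removable box; their even positions
    are the letters of [cups h]. *)
Lemma zigzag_peak h p P Q s : zigzag h p = P ++ true :: false :: Q ->
  height s P = s /\ exists2 j, (j < h)%N & size P = j.*2.
Proof.
elim: h P s => [|h IH] P s.
  move=> H; have: false \in nseq p true by rewrite [nseq _ _]H mem_cat !inE /= orbT.
  by rewrite mem_nseq andbF.
case: P => [|x [|y P]] /=; first by split=> //; exists 0.
  by case.
by case=> <- <- /(IH _ s) /= [-> [j Hj ->]]; split=> //; exists j.+1.
Qed.

(* [rep h u S]: the ballot word S, read as a lattice path, is obtained from the
   zigzag with h down steps by adding the boxes u (a box at i turns a valley
   into a peak).  The diagram of u ++ cups h then has S as its upper half: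
   openings of cups and through strands are true, closings are false. *)
Inductive rep (h : nat) : seq nat -> seq bool -> Prop :=
| rep_nil : rep h [::] (zigzag h (m.+1 - h.*2))
| rep_box u P Q : rep h u (P ++ false :: true :: Q) ->
                  rep h (size P :: u) (P ++ true :: false :: Q).

Section Rep.
Variable h : nat.
Hypothesis hm : (h.*2 <= m.+1)%N.

Lemma rep_size u S : rep h u S -> size S = m.+1.
Proof.
by elim=> [|{}u P Q _]; rewrite ?size_zigzag ?subnKC // !size_cat.
Qed.

Lemma rep_ballot u S : rep h u S -> ballot 0 S.
Proof.
elim=> [|{}u P Q _]; last by rewrite ballot_valley => /andP[].
exact: ballot_zigzag.
Qed.

Lemma rep_downs u S : rep h u S -> count negb S = h.
Proof.
elim=> [|{}u P Q _]; last by rewrite !count_cat.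
rewrite /zigzag count_cat count_nseq mul0n addn0.
by elim: h => //= p ->.
Qed.

Lemma rep_bound u S : rep h u S -> all (fun i => i < m)%N u.
Proof.
elim=> [//|{}u P Q /rep_size] /= + ->; rewrite size_cat /= andbT.
by lia.
Qed.

(** A peak is a cup joining two neighbouring points, so its letter can be brought to the front.
    Either it is the last box, or the last box is a disjoint peak and the two letters commute; in
    the zigzag it is a letter of [cups h]. *)
Lemma rep_peak u P Q : rep h u (P ++ true :: false :: Q) ->
  exists v, u ++ cups h ~~> size P :: v.
Proof.
move: {-2}(_ ++ _) (erefl (P ++ true :: false :: Q)) => S + H.
elim: H P Q => [|{}u P0 Q0 Hu IH] P Q E.
  have [_ [j Hj ->]] := zigzag_peak 0 E.
  exact: cups_front.
have HP : (size P0 < m)%N.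
  by have := rep_size Hu; rewrite size_cat /=; lia.
have HP' : (size P < m)%N.
  have := rep_size (rep_box Hu); rewrite E size_cat /=; lia.
case: (ltngtP (size P) (size P0)) => C.
- have [R [E1 E2]] := two_peaks (esym E) C.
  have [|v Hv] := IH P (R ++ false :: true :: Q0).
    by rewrite E1 -catA.
  exists (size P0 :: v).
  apply: teq_trans (tlred_catl [:: size P0] Hv) _.
  by apply: teq_far; rewrite // /far E1 size_cat /=; lia.
- have [R [E1 E2]] := two_peaks E C.
  have [|v Hv] := IH (P0 ++ false :: true :: R) Q.
    by rewrite E2 -catA.
  have Es : size (P0 ++ false :: true :: R) = size P by rewrite E1 !size_cat.
  rewrite Es in Hv; exists (size P0 :: v).
  apply: teq_trans (tlred_catl [:: size P0] Hv) _.
  by apply: teq_far; rewrite // /far E1 size_cat /=; lia.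
- by exists (u ++ cups h); rewrite C; exact: tlred_refl.
Qed.

(** A peak of positive height is absent from the zigzag, hence comes from a box. Boxes added later
    sit at disjoint peaks and commute with it. The exact count of boxes feeds the induction in
    [rep_letter]. *)
Lemma rep_remove u P Q : rep h u (P ++ true :: false :: Q) ->
  (0 < height 0 P)%N ->
  exists v, [/\ u ~~> size P :: v, rep h v (P ++ false :: true :: Q)
              & size u = (size v).+1].
Proof.
move: {-2}(_ ++ _) (erefl (P ++ true :: false :: Q)) => S + H.
elim: H P Q => [|{}u P0 Q0 Hu IH] P Q E H0.
  by have [E0 _] := zigzag_peak 0 E; rewrite E0 in H0.
have HP : (size P0 < m)%N.
  by have := rep_size Hu; rewrite size_cat /=; lia.
have HP' : (size P < m)%N.
  have := rep_size (rep_box Hu); rewrite E size_cat /=; lia.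
have H0' : (0 < height 0 P0)%N.
  by have := rep_ballot Hu; rewrite ballot_valley => /andP[].
case: (ltngtP (size P) (size P0)) => C.
- have [R [E1 E2]] := two_peaks (esym E) C.
  have [| |v [Hv Hr Hs]] := IH P (R ++ false :: true :: Q0) => //.
    by rewrite E1 -catA.
  exists (size P0 :: v); split; last by rewrite /= Hs.
    apply: teq_trans (tlred_catl [:: size P0] Hv) _.
    by apply: teq_far; rewrite // /far E1 size_cat /=; lia.
  have := @rep_box h v (P ++ false :: true :: R) Q0.
  by rewrite -!catA E1 E2 !size_cat; apply.
- have [R [E1 E2]] := two_peaks E C.
  have Es : size (P0 ++ false :: true :: R) = size P by rewrite E1 !size_cat.
  have [| |v [Hv Hr Hs]] := IH (P0 ++ false :: true :: R) Q.
  + by rewrite E2 -catA.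
  + by rewrite height_valley // -height_peak -E1.
  exists (size P0 :: v); split; last by rewrite /= Hs.
    rewrite Es in Hv.
    apply: teq_trans (tlred_catl [:: size P0] Hv) _.
    by apply: teq_far; rewrite // /far E1 size_cat /=; lia.
  have := @rep_box h v P0 (R ++ false :: true :: Q).
  by rewrite E1 -!catA; apply; move: Hr; rewrite -catA.
- exists u; split=> //; first by rewrite C; exact: tlred_refl.
  by move/eqP: E; rewrite eqseq_cat // => /andP[/eqP <- /eqP[<-]].
Qed.

(** The last box of the first word is also removable from the second, so both shrink together down
    to the zigzag, which has no removable box. *)
Lemma rep_uniq u u' S : rep h u S -> rep h u' S -> u ~~> u'.
Proof.
move=> H; elim: H u' => [|{}u P Q Hu IH] u' Hu'.
  inversion Hu' as [E|v P Q Hv E1 E2]; first exact: tlred_refl.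
  have [E0 _] := zigzag_peak 0 (esym E2).
  by have := rep_ballot Hv; rewrite ballot_valley E0.
have := rep_ballot Hu; rewrite ballot_valley => /andP[H0 _].
have [v [Hv Hr _]] := rep_remove Hu' H0.
apply: teq_trans (tlred_sym Hv).
exact: (tlred_catl [:: size P] (IH _ Hr)).
Qed.

(** A box after the prefix P leaves a letter false at position [(size P).+1], which must therefore
    be less than l; removing the box does not touch the letters from l on. *)
Lemma rep_tail u S l : rep h u S ->
  (forall j, (l <= j)%N -> nth true S j = true) -> all (fun j => j.+1 < l)%N u.
Proof.
move=> H; elim: H l => //= {}u P Q Hu IH l Hl.
have HP : ((size P).+1 < l)%N.
  rewrite ltnNge; apply/negP => /Hl.
  by rewrite nth_cat ltnNge leqnSn subSnn.
rewrite HP /=; apply: IH => j Hj; have := Hl j Hj; rewrite !nth_cat.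
case: ifP => // Hj'.
have -> : (j - size P = (j - size P).-2.+2)%N by move: HP Hj Hj'; clear; lia.
by [].
Qed.

End Rep.

(** * Multiplying a normal word by a letter *)

Lemma true_prefix S :
  S = nseq (size S) true \/ exists p Q, S = nseq p true ++ false :: Q.
Proof.
elim: S => [|[] S IH]; [by left| |by right; exists 0%N, S].
case: IH => [E|[p [Q ->]]]; first by left; rewrite /= -E.
by right; exists p.+1, Q.
Qed.

Lemma false_suffix S :
  S = nseq (size S) false \/ exists p P, S = P ++ true :: nseq p false.
Proof.
elim/last_ind: S => [|S [] IH]; [by left| |].
  by right; exists 0%N, S; rewrite cats1.
have E p : rcons (nseq p false) false = nseq p.+1 false.
  by rewrite -cats1 -[[:: false]]/(nseq 1 false) -nseqD addn1.
case: IH => [->|[p [P ->]]].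
  by left; rewrite size_rcons size_nseq E.
by right; exists p.+1, P; rewrite rcons_cat /= E.
Qed.

(** Each step rewrites a letter by means of (i+1) i (i+1) = (i+1), lowering the middle letter by
    one. The left factor keeps only letters above j, so for j = 2h it commutes with [cups h]. *)
Lemma teq_descent j d : (j + d < m)%N ->
  exists a b, all (fun i => j < i < m)%N a /\ [:: (j + d)%N] ~~> a ++ j :: b.
Proof.
elim: d => [|d IH] H.
  by exists [::], [::]; rewrite addn0; split=> //; exact: tlred_refl.
have [|a [b [Ha Hab]]] := IH; first by lia.
exists ((j + d).+1 :: a), (b ++ [:: (j + d).+1]); split.
  by rewrite /= Ha andbT; lia.
rewrite addnS; apply: teq_trans (tlred_sym (tlred_braid2 _)) _; first by lia.
have := tlred_ctx [:: (j + d).+1] [:: (j + d).+1] Hab.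
by rewrite /= -catA.
Qed.

(** Here the letter i joins two through strands, which creates one more cup. It commutes past u and
    [cups h], and [teq_descent] then extracts the letter 2h that completes [cups h.+1]. *)
Lemma tail_absorb h u P i p : (h.*2 <= m.+1)%N -> (i < m)%N ->
  size P = i -> rep h u (P ++ nseq p true) ->
  (h.+1.*2 <= m.+1)%N /\
  exists c a b, tlred (i :: u ++ cups h) c (a ++ cups h.+1 ++ b).
Proof.
move=> hm Hi HP Hu.
have Hb := rep_bound hm Hu.
have Hf : all (fun j => j.+1 < i)%N u.
  apply: (rep_tail Hu) => j Hj.
  by rewrite nth_cat HP ltnNge Hj /= nth_nseq; case: ifP.
(* The prefix P is a ballot word containing all h letters false, so its length is at least 2h. *)
have Hh : (h.*2 <= i)%N.
  have := rep_downs Hu; rewrite count_cat count_nseq mul0n addn0 => E.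
  have := rep_ballot Hu; rewrite ballot_cat => /andP[/ballot_size B _].
  have := count_predC id P; have -> : count (predC id) P = h by [].
  by move: B; rewrite HP; lia.
split; first by lia.
have Hc := cups_bound h.
have [d Ed] : exists d, i = (h.*2 + d)%N by exists (i - h.*2)%N; lia.
have Hd : (h.*2 + d < m)%N by rewrite -Ed.
have [a [b [Ha Hab]]] := teq_descent Hd; rewrite -Ed in Hab.
exists 1, (u ++ a), b.
apply: (@teq_trans (u ++ i :: cups h)).
  have -> : u ++ i :: cups h = (u ++ [:: i]) ++ cups h by rewrite -catA.
  apply: (@tlred_catr _ (i :: u)); apply: teq_move => //.
  by apply/allP => j Hj; move/allP/(_ j Hj): Hb; move/allP/(_ j Hj): Hf; rewrite /far; lia.
rewrite -catA; apply: tlred_catl.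
apply: (@teq_trans (cups h ++ [:: i])).
  apply: teq_move => //.
  by apply: sub_all Hc => j; rewrite /far; lia.
apply: teq_trans (tlred_catl (cups h) Hab) _.
rewrite /= -cats1 -!catA /= !catA; apply: tlred_catr; apply: tlred_sym.
apply: teq_move_cat; first by apply: sub_all Ha => j; lia.
apply: sub_all Ha => j Hj; apply: sub_all Hc => l; rewrite /far; lia.
Qed.

Lemma cat_cons2 i S : (i.+1 < size S)%N ->
  exists P x y Q, S = P ++ x :: y :: Q /\ size P = i.
Proof.
elim: i S => [|i IH] [|x [|y S]] // H; first by exists [::], x, y, S.
by have [P [x' [y' [Q [-> <-]]]]] := IH (y :: S) H; exists (x :: P), x', y', Q.
Qed.

(* The bound n on the number of boxes is what lets the induction of rep_letter
   be used a second time in absorbs_far, on the result of its first use. *)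
Definition absorbs h n i u :=
  (exists c u' S', [/\ rep h u' S', tlred (i :: u ++ cups h) c (u' ++ cups h)
                     & (size u' <= n)%N]) \/
  (h.+1.*2 <= m.+1)%N /\
    exists c a b, tlred (i :: u ++ cups h) c (a ++ cups h.+1 ++ b).

Lemma absorbs_leq n' h n i u : (n' <= n)%N -> absorbs h n' i u -> absorbs h n i u.
Proof.
move=> Hn [[c [v [S [Hv Hc Hs]]]]|?]; last by right.
by left; exists c, v, S; split=> //; exact: leq_trans Hn.
Qed.

(** The peak of v at i lets [v ++ cups h] start with i. Then i j i collapses to i, which leaves
    v. *)
Lemma absorbs_braid h u v S i j P Q : (h.*2 <= m.+1)%N -> 
  (i.+1 == j) || (j.+1 == i) -> (i < m)%N -> (j < m)%N ->
  u ~~> j :: v -> rep h v S -> S = P ++ true :: false :: Q -> size P = i ->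
  absorbs h (size v) i u.
Proof.
move=> hm Hij Hi Hj Hv Hr ES HP; rewrite ES in Hr.
have [w] := rep_peak hm Hr; rewrite HP => Hw.
left; exists 1, v, (P ++ [:: true, false & Q]); split=> //.
apply: teq_trans (tlred_catl [:: i] (tlred_catr _ Hv)) _.
apply: teq_trans (tlred_catl [:: i; j] Hw) _.
apply: teq_trans (tlred_sym Hw).
case/orP: Hij Hi Hj => /eqP <- Hi Hj.
  exact: (tlred_catr w (tlred_braid1 _)).
exact: (tlred_catr w (tlred_braid2 _)).
Qed.

(** The letter i passes j and acts on v first; the outcome has at most as many boxes as v, so the
    induction hypothesis applies again to the letter j. *)
Lemma absorbs_far h u v i j : (h.*2 <= m.+1)%N ->
  (forall w P x y Q l, (size w <= size v)%N -> rep h w (P ++ x :: y :: Q) ->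
     size P = l -> absorbs h (size w + (~~ x && y)) l w) ->
  far i j -> (i < m)%N -> (j < m)%N ->
  u ~~> j :: v -> absorbs h (size v) i v -> absorbs h (size v).+1 i u.
Proof.
move=> hm IH Hij Hi Hj Hv Ha.
have H1 : i :: u ++ cups h ~~> j :: i :: v ++ cups h.
  apply: teq_trans (tlred_catl [:: i] (tlred_catr _ Hv)) _.
  exact: teq_far.
case: Ha => [[c [u' [S' [Hu' Hc Hs']]]]|[Hh [c [a [b Hab]]]]]; last first.
  right; split=> //; exists c, (j :: a), b.
  exact: teq_tlred H1 (tlred_catl [:: j] Hab).
have [P [x [y [Q [E2 HP2]]]]] : exists P x y Q, S' = P ++ x :: y :: Q /\ size P = j.
  by apply: cat_cons2; rewrite (rep_size hm Hu'); lia.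
rewrite E2 in Hu'.
have [[c' [w [T [Hw Hc' Hsw]]]]|[Hh [c' [a [b Hc']]]]] := IH _ _ _ _ _ _ Hs' Hu' HP2.
  left; exists (c * c'), w, T; split=> //.
    exact: teq_tlred H1 (tlred_trans (tlred_catl [:: j] Hc) Hc').
  by apply: leq_trans Hsw _; rewrite -addn1 leq_add // leq_b1.
right; split=> //; exists (c * c'), a, b.
exact: teq_tlred H1 (tlred_trans (tlred_catl [:: j] Hc) Hc').
Qed.

(** The cases follow the two steps of the path at i. A valley receives a box, and a peak yields the
    factor xi. On a slope, the box at the nearest peak uphill is removed; i is absorbed with it if
    the letters are adjacent, and commutes with it otherwise. *)
Lemma rep_letter h u P x y Q i : (h.*2 <= m.+1)%N -> rep h u (P ++ x :: y :: Q) ->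
  size P = i -> absorbs h (size u + (~~ x && y)) i u.
Proof.
move=> hm; have [N] := ubnP (size u).
elim: N u P x y Q i => // N IH u P x y Q i HN Hu HP.
have Hm := rep_size hm Hu; rewrite size_cat HP /= in Hm.
have Hi : (i < m)%N by lia.
case: x y Hu => -[] Hu; rewrite /= ?addn0.
(* Up slope: without a later down step both strands are through strands; otherwise the nearest peak
   is to the right, at position i + p + 1. *)
- case: (true_prefix Q) => [E|[p [Q' E]]]; rewrite E in Hu.
    by right; apply: (@tail_absorb h u P i (size Q).+2).
  case: p E Hu => [|p] E Hu.
    have E1 : P ++ [:: true, true, false & Q'] = (P ++ [:: true]) ++ true :: false :: Q'.
      by rewrite -catA.
    rewrite E1 in Hu.
    have [|v [Hv Hr ->]] := rep_remove hm Hu; first by rewrite height_cat /=.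
    rewrite size_cat HP addn1 in Hv.
    apply: (absorbs_leq (n' := size v)) => //.
    apply: (absorbs_braid hm _ Hi _ Hv Hr (P := P) (Q := true :: Q')) => //.
    + by rewrite eqxx.
    + by move: Hm; rewrite E /=; lia.
    + by rewrite -catA.
  have E1 : P ++ [:: true, true & nseq p.+1 true ++ false :: Q'] =
            (P ++ [:: true, true & nseq p true]) ++ true :: false :: Q'.
    by rewrite -catA /= -[true :: nseq _ _ ++ _]/(nseq p.+1 true ++ _) -addn1 nseqD -catA.
  rewrite E1 in Hu.
  have [|v [Hv Hr Hs]] := rep_remove hm Hu.
    by rewrite height_cat /= height_nseq.
  rewrite Hs; apply: (absorbs_far hm _ _ Hi _ Hv).
  + by move=> w P1 x y Q1 l Hw; apply: IH; lia.
  + by rewrite /far size_cat HP /=; lia.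
  + by move: Hm; rewrite E !size_cat HP /= !size_nseq /=; lia.
  + rewrite -[size v]addn0; rewrite -catA /= in Hr.
    by apply: (IH v _ _ _ _ _ _ Hr HP); lia.
- have [v Hv] := rep_peak hm Hu; rewrite HP in Hv.
  left; exists xi, u, (P ++ [:: true, false & Q]); split=> //.
  apply: tlred_teq (tlred_sym Hv).
  apply: teq_tlred (tlred_catl [:: i] Hv) _.
  exact: (tlred_catr v (tlred_sq Hi)).
- left; exists 1, (i :: u), (P ++ [:: true, false & Q]); split.
  + by rewrite -HP; exact: rep_box.
  + exact: tlred_refl.
  + by rewrite /= addn1.
(* Down slope: the ballot condition forces an earlier up step, so the nearest peak is to the left,
   at the end of P'. *)
- have Hb := rep_ballot Hu.
  case: (false_suffix P) => [E|[p [P' E]]].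
    by move: Hb; rewrite E ballot_cat; case: (size P) => [|?] /=; rewrite ?andbF.
  have Es : (size P' + p.+1 = i)%N by rewrite -HP E size_cat /= size_nseq.
  have E1 : P ++ [:: false, false & Q] =
            P' ++ true :: nseq p.+1 false ++ false :: Q.
    by rewrite E -catA /= -[false :: _ :: Q]/(nseq 1 false ++ _) catA -nseqD addn1.
  have H0 : (0 < height 0 P')%N.
    move: Hb; rewrite E1 ballot_cat /= => /andP[_].
    by case: (p) => [|?] /= /andP[].
  rewrite E1 in Hu.
  have [v [Hv Hr Hs]] := rep_remove hm Hu H0; rewrite Hs.
  case: p E Es E1 Hu Hr => [|p] E Es E1 Hu Hr.
    apply: (absorbs_leq (n' := size v)) => //.
    apply: (absorbs_braid hm _ Hi _ Hv Hr (P := P' ++ [:: false]) (Q := Q)) => //.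
    + by rewrite -Es addn1 eqxx orbT.
    + by lia.
    + by rewrite -catA.
    + by rewrite size_cat.
  apply: (absorbs_far hm _ _ Hi _ Hv).
  + by move=> w P1 x y Q1 l Hw; apply: IH; lia.
  + by rewrite /far; lia.
  + by lia.
  + rewrite -[size v]addn0.
    have E2 : P' ++ [:: false, true & nseq p.+1 false ++ false :: Q] =
              (P' ++ [:: false, true & nseq p false]) ++ [:: false, false & Q].
      by rewrite -catA /= -[false :: nseq _ _ ++ _]/(nseq p.+1 false ++ _) -addn1 nseqD -catA.
    rewrite E2 in Hr.
    apply: (IH v _ _ _ _ _ _ Hr); first by lia.
    by rewrite -Es size_cat /= size_nseq.
Qed.

Lemma rep_left h a : (h.*2 <= m.+1)%N -> all (fun i => i < m)%N a ->
  (exists c u S, rep h u S /\ tlred (a ++ cups h) c (u ++ cups h)) \/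
  (h.+1.*2 <= m.+1)%N /\
    exists c a' b, tlred (a ++ cups h) c (a' ++ cups h.+1 ++ b).
Proof.
move=> hm; elim: a => [|i a IH] /=.
  move=> _; left; exists 1, [::], (zigzag h (m.+1 - h.*2)); split.
    exact: rep_nil.
  exact: tlred_refl.
case/andP => Hi /IH [[c [u [S [Hu Hc]]]]|[Hh [c [a' [b Hab]]]]]; last first.
  by right; split=> //; exists c, (i :: a'), b; exact: (tlred_catl [:: i] Hab).
have [P [x [y [Q [E HP]]]]] : exists P x y Q, S = P ++ x :: y :: Q /\ size P = i.
  by apply: cat_cons2; rewrite (rep_size hm Hu); lia.
rewrite E in Hu.
case: (rep_letter hm Hu HP) => [[c' [u' [S' [Hu' Hc' _]]]]|[Hh [c' [a' [b Hab]]]]].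
  left; exists (c * c'), u', S'; split=> //.
  exact: tlred_trans (tlred_catl [:: i] Hc) Hc'.
right; split=> //; exists (c * c'), a', b.
exact: tlred_trans (tlred_catl [:: i] Hc) Hab.
Qed.

Lemma tlred_all u c v :
  tlred u c v -> all (fun i => i < m)%N u = all (fun i => i < m)%N v.
Proof.
elim=> {u c v} [//|u c v c' w _ -> _ -> //|//|a b u c v _|i j|i|i|i] /=.
- by rewrite !all_cat => ->.
- by case/andP=> H1 H2; rewrite H2 (ltn_trans (ltnW H1) H2).
- by move->.
- by move=> H; rewrite H (ltnW H).
- by move=> H; rewrite H (ltnW H).
Qed.

(** The left factor is reduced by [rep_left], the right one by the same lemma after reversal.
    Whenever a reduction fails, the word factors through [cups h.+1], which can happen only finitely
    often because 2h is at most m + 1. *)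
Lemma rep_span_cups h a b : (h.*2 <= m.+1)%N ->
  all (fun i => i < m)%N a -> all (fun i => i < m)%N b ->
  exists c h' u S v T, [/\ (h'.*2 <= m.+1)%N, rep h' u S, rep h' v T
    & tlred (a ++ cups h ++ b) c (u ++ cups h' ++ rev v)].
Proof.
have [N] := ubnP (m.+1 - h.*2)%N.
elim: N h a b => // N IH h a b HN hm Ha Hb.
have Hcups : all (fun j => j < m)%N (cups h).
  by apply: sub_all (cups_bound h) => j; lia.
case: (rep_left hm Ha) => [[c [u [S [Hu Hc]]]]|[Hh [c [a' [b' Hab]]]]]; last first.
  have := tlred_all Hab; rewrite !all_cat Ha Hcups => /esym/and3P[Ha' _ Hb'].
  have [||c' [h' [u [S [v [T [H1 H2 H3 H4]]]]]]] := IH h.+1 a' (b' ++ b) _ Hh Ha'.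
  - by lia.
  - by rewrite all_cat Hb'.
  exists (c * c'), h', u, S, v, T; split=> //.
  apply: tlred_trans H4; have := tlred_catr b Hab.
  by rewrite -!catA.
have Hb2 : all (fun i => i < m)%N (rev b) by rewrite all_rev.
case: (rep_left hm Hb2) => [[c' [v [T [Hv Hc']]]]|[Hh [c' [a' [b' Hab]]]]].
  exists (c * c'), h, u, S, v, T; split=> //.
  rewrite catA; apply: tlred_trans (tlred_catr b Hc) _.
  rewrite -catA; apply: tlred_catl.
  have := tlred_rev Hc'; rewrite !rev_cat revK => Hr.
  apply: teq_tlred (tlred_catr b (tlred_sym (teq_rev_cups hm))) _.
  exact: tlred_teq Hr (tlred_catr _ (teq_rev_cups hm)).
have := tlred_all Hab; rewrite !all_cat Hb2 Hcups => /esym/and3P[Ha' _ Hb'].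
have [|||c2 [h' [u' [S' [v [T [H1 H2 H3 H4]]]]]]] :=
  IH h.+1 (u ++ rev b') (rev a') _ Hh.
- by lia.
- by rewrite all_cat (rep_bound hm Hu) all_rev.
- by rewrite all_rev.
exists (c * c' * c2), h', u', S', v, T; split=> //.
apply: tlred_trans H4; rewrite catA; apply: tlred_trans (tlred_catr b Hc) _.
rewrite -!catA; apply: tlred_catl.
apply: teq_tlred (tlred_catr b (tlred_sym (teq_rev_cups hm))) _.
have := tlred_rev Hab; rewrite !rev_cat revK -!catA => /tlred_teq; apply.
apply: tlred_catl; apply: tlred_catr.
exact: (teq_rev_cups Hh).
Qed.

Lemma rep_span w : all (fun i => i < m)%N w ->
  exists c h u S v T, [/\ (h.*2 <= m.+1)%N, rep h u S, rep h v T
    & tlred w c (u ++ cups h ++ rev v)].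
Proof. by move=> Hw; have := @rep_span_cups 0 w [::] isT Hw isT; rewrite !cats0. Qed.

(** * Every ballot word is reached from a zigzag by adding boxes *)

Fixpoint area S : nat :=
  match S with
  | [::] => 0
  | true :: S' => (size S').+1 + area S'
  | false :: S' => area S'
  end.

Lemma area_peak P Q : area (P ++ true :: false :: Q) = (area (P ++ false :: true :: Q)).+1.
Proof. by elim: P => [|[] P IH] //=; rewrite IH !size_cat /= ?addnS. Qed.

Lemma zigzag_or_peak S : ballot 0 S ->
  (exists h p, S = zigzag h p) \/
  exists P Q, S = P ++ true :: false :: Q /\ (0 < height 0 P)%N.
Proof.
have [N] := ubnP (size S); elim: N S => // N IH [|[] [|[] S]] //= HN Hb.
- by left; exists 0%N, 0%N.
- by left; exists 0%N, 1%N.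
- case: (true_prefix S) => [E|[p [Q E]]].
    by left; exists 0%N, (size S).+2; rewrite {1}E.
  right; exists (true :: nseq p true), Q; split.
    by rewrite E /= -[true :: nseq _ _ ++ _]/(nseq p.+1 true ++ _) -addn1 nseqD -catA.
  by rewrite /= height_nseq.
case: (IH S) => [||[h [p ->]]|[P [Q [-> HP]]]] //.
- by lia.
- by left; exists h.+1, p.
- by right; exists [:: true, false & P], Q.
Qed.

(** As long as the path is not a zigzag it has a peak above the ground; turning it into a valley
    lowers the area by one. *)
Lemma rep_exists S : size S = m.+1 -> ballot 0 S -> exists u, rep (count negb S) u S.
Proof.
have [N] := ubnP (area S); elim: N S => // N IH S HN HS Hb.
case: (zigzag_or_peak Hb) => [[h [p E]]|[P [Q [E HP]]]].
  have -> : count negb S = h.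
    rewrite E /zigzag count_cat count_nseq mul0n addn0.
    by elim: (h) => //= ? ->.
  exists [::]; have -> : S = zigzag h (m.+1 - h.*2); last exact: rep_nil.
  by rewrite E; congr zigzag; rewrite -HS E size_zigzag addKn.
have [|||u Hu] := IH (P ++ false :: true :: Q).
- by move: HN; rewrite E area_peak.
- by rewrite -HS E !size_cat.
- by rewrite ballot_valley HP -E.
exists (size P :: u); rewrite E; apply: rep_box.
by move: Hu; rewrite !count_cat.
Qed.

End TLWords.

(** * Matrices of the generators and of the R-matrix *)

Definition wd k (x : tpb 2 k) : seq bool := [seq x i == 1%N :> nat | i <- enum 'I_k].
Definition ofb (b : bool) : 'I_2 := if b then ord_max else ord0.
Definition ofw k (s : seq bool) : tpb 2 k := [ffun i : 'I_k => ofb (nth false s i)].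

Lemma size_wd k (x : tpb 2 k) : size (wd x) = k.
Proof. by rewrite size_map size_enum_ord. Qed.

Lemma nth_wd k (x : tpb 2 k) (i : 'I_k) : nth false (wd x) i = (x i == 1%N :> nat).
Proof. by rewrite (nth_map i) ?size_enum_ord // nth_ord_enum. Qed.

Lemma ofb_eq1 b : (ofb b == 1%N :> nat) = b.
Proof. by case: b. Qed.

Lemma eq1_ofb (a : 'I_2) : ofb (a == 1%N :> nat) = a.
Proof. by apply/val_inj; case: a => -[|[]]. Qed.

Lemma wdK k : cancel (@wd k) (@ofw k).
Proof. by move=> x; apply/ffunP => i; rewrite ffunE nth_wd eq1_ofb. Qed.

Lemma ofwK k s : size s = k -> wd (ofw k s) = s.
Proof.
move=> Hs; apply: (@eq_from_nth _ false); rewrite size_wd // => i Hi.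
by rewrite (nth_wd _ (Ordinal Hi)) ffunE ofb_eq1.
Qed.

Lemma wd_cons k (x : tpb 2 k.+1) : wd x = (Defs.thead x == 1%N :> nat) :: wd (ttail x).
Proof.
rewrite /wd enum_ordSl /= -map_comp; congr (_ :: _).
by apply: eq_map => i /=; rewrite ffunE.
Qed.

Lemma sum_tpbS (K : fieldType) k (F : tpb 2 k.+1 -> K) :
  \sum_z F z = \sum_(b : bool) \sum_(t : tpb 2 k) F (ofw k.+1 (b :: wd t)).
Proof.
rewrite pair_big /= (reindex (fun p : bool * tpb 2 k => ofw k.+1 (p.1 :: wd p.2))) //=.
exists (fun z => (Defs.thead z == 1%N :> nat, ttail z)) => [[b t]|z] _ /=.
  have := wd_cons (ofw k.+1 (b :: wd t)).
  rewrite ofwK /= ?size_wd // => -[<-] /(congr1 (@ofw k)).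
  by rewrite !wdK => <-.
by rewrite -wd_cons wdK.
Qed.

Lemma thead_ofw k b s : Defs.thead (ofw k.+1 (b :: s)) = ofb b.
Proof. by rewrite /Defs.thead ffunE. Qed.

Lemma ttail_ofw k b s : ttail (ofw k.+1 (b :: s)) = ofw k s.
Proof. by apply/ffunP => i; rewrite !ffunE. Qed.

Lemma sum_delta (K : fieldType) (I : finType) (i : I) (F : I -> K) :
  \sum_j (i == j)%:R * F j = F i.
Proof.
rewrite (bigD1 i) //= eqxx mul1r big1 ?addr0 // => j Hj.
by rewrite eq_sym (negbTE Hj) mul0r.
Qed.

Lemma sum_root_of_unity (K : fieldType) n (z : K) :
  z ^+ n = 1 -> z != 1 -> \sum_(t < n) z ^+ t = 0.
Proof.
move=> Hz z1; apply/eqP; have := subrX1 z n.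
rewrite Hz subrr => /esym/eqP; rewrite mulf_eq0 subr_eq0.
by rewrite (negbTE z1).
Qed.

Lemma wd_letter k (x : tpb 2 k) (j : 'I_k) : x j = ofb (nth false (wd x) j).
Proof. by rewrite nth_wd eq1_ofb. Qed.

Lemma prod_eq_outside (K : fieldType) k (i : 'I_k.-1) (x z : tpb 2 k) P a b Q P' c d Q' :
  wd x = P ++ a :: b :: Q -> wd z = P' ++ c :: d :: Q' ->
  size P = i -> size P' = i ->
  \prod_(j : 'I_k | (j != pos0 i) && (j != pos1 i)) (x j == z j)%:R
    = ((P == P') && (Q == Q'))%:R :> K.
Proof.
move=> Ex Ez HP HP'.
have Hk : (i + (size Q).+2)%N = k by have := size_wd x; rewrite Ex size_cat HP.
have Hk' : (i + (size Q').+2)%N = k by have := size_wd z; rewrite Ez size_cat HP'.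
case: (boolP ((P == P') && (Q == Q'))) => [/andP[/eqP EP /eqP EQ]|H].
  rewrite big1 // => j /andP[Hj0 Hj1].
  rewrite !wd_letter Ex Ez -EP -EQ !nth_cat HP; case: ltnP => Hj; first by rewrite eqxx.
  have -> : (j - i = (j - i).-2.+2)%N; last by rewrite eqxx.
  by move: Hj0 Hj1; rewrite -!val_eqE /=; move: Hj; clear; lia.
(* When P and P', or Q and Q', differ, they do so at an index away from i and i + 1, and that factor
   of the product is 0. *)
have [j [Hj Hxz]] : exists j : 'I_k, ((j != pos0 i) && (j != pos1 i)) /\ x j != z j.
  have [j [Hj Hn2]] : exists j, (j < k)%N /\ [/\ j != i, j != i.+1 &
      nth false (wd x) j != nth false (wd z) j].
    move: H; rewrite negb_and => /orP[]/eqP HPQ; last first.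
      case: (pickP (fun t : 'I_(size Q) => nth false Q t != nth false Q' t)) => [t Ht|Ht].
        exists (i + t.+2)%N; split; first by have := ltn_ord t; lia.
        split; try lia.
        rewrite Ex Ez !nth_cat HP HP' ltnNge leq_addr /= addKn.
        exact: Ht.
      case: HPQ; apply: (@eq_from_nth _ false); first by lia.
      by move=> t Ht'; apply/eqP; have /negbFE := Ht (Ordinal Ht').
    case: (pickP (fun t : 'I_(size P) => nth false P t != nth false P' t)) => [t Ht|Ht].
      have Ht' := ltn_ord t; exists t; split; first by lia.
      split; try lia.
      by rewrite Ex Ez !nth_cat Ht' HP' -HP Ht'.
    case: HPQ; apply: (@eq_from_nth _ false); first by rewrite HP HP'.
    by move=> t Ht'; apply/eqP; have /negbFE := Ht (Ordinal Ht').
  case: Hn2 => Hj0 Hj1 Hn2; exists (Ordinal Hj); rewrite -!val_eqE /= Hj0 Hj1; split=> //.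
  by apply: contra Hn2 => /eqP E; rewrite !(nth_wd _ (Ordinal Hj)) E.
by rewrite (bigD1 j) //= (negbTE Hxz) mul0r.
Qed.

Lemma sum_wd (K : fieldType) k w (F : seq bool -> K) : size w = k ->
  \sum_(z : tpb 2 k) (wd z == w)%:R * F (wd z) = F w.
Proof.
move=> Hw; rewrite -[in RHS](ofwK Hw) -(sum_delta (ofw k w) (fun z => F (wd z))).
apply: eq_bigr => z _; congr (_%:R * _).
by rewrite -{1}(ofwK Hw) (can_eq (@wdK _)) eq_sym.
Qed.

Lemma split_at k (i : 'I_k.-1) (x : tpb 2 k) :
  exists P a b Q, wd x = P ++ a :: b :: Q /\ size P = i.
Proof. by apply: cat_cons2; rewrite size_wd; exact: ltn_pos1. Qed.

Lemma sum_local (K : fieldType) k (i : 'I_k.-1) (L : bool -> bool -> K) (G : tpb 2 k -> K) F P Q :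
  size P = i -> (size P + (size Q).+2)%N = k ->
  (forall z P' c d Q', wd z = P' ++ c :: d :: Q' -> size P' = i ->
     G z = L c d * ((P == P') && (Q == Q'))%:R) ->
  \sum_z G z * F (wd z) = \sum_(c : bool) \sum_(d : bool) L c d * F (P ++ c :: d :: Q).
Proof.
move=> HP Hk HG.
transitivity (\sum_(c : bool) \sum_(d : bool)
    L c d * \sum_(z : tpb 2 k) (wd z == P ++ c :: d :: Q)%:R * F (wd z)); last first.
  apply: eq_bigr => c _; apply: eq_bigr => d _.
  by rewrite sum_wd // size_cat.
transitivity (\sum_(z : tpb 2 k) \sum_(c : bool) \sum_(d : bool)
    L c d * ((wd z == P ++ c :: d :: Q)%:R * F (wd z))).
  apply: eq_bigr => z _; have [P' [c [d [Q' [Ez HP']]]]] := split_at i z.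
  rewrite (HG _ _ _ _ _ Ez HP') !big_bool Ez /=.
  rewrite !eqseq_cat ?HP ?HP' // !eqseq_cons [P == P']eq_sym [Q == Q']eq_sym.
  by case: (P' == P); case: (Q' == Q); case: c {Ez}; case: d => /=; ring.
rewrite exchange_big; apply: eq_bigr => c _ /=.
rewrite exchange_big; apply: eq_bigr => d _ /=.
by rewrite mulr_sumr.
Qed.

Section RMatrix.
Variables (K : fieldType) (n : nat) (q : K).
Hypotheses (Hn : (2 <= n)%N) (Hq : n.-primitive_root q) (n0 : n%:R != 0 :> K).
Variables (qh : K) (r : nat).
Hypothesis Hqh : qh ^+ 2 = q.

Let act := Vact q 2 r%:Z.
Let th := q ^+ r.
Let lam := q ^ (- (r * r.+1)%:Z).

Let q0 : q != 0 := primitive_root_neq0 Hq.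
Let th0 : th != 0. Proof. exact: expf_neq0. Qed.
Let h0 : qh != 0. Proof. by apply: contraNneq q0 => E; rewrite -Hqh E expr0n. Qed.

Definition gam (a : 'I_2) : K := if a == 1%N :> nat then th^-1 else (q * th)^-1.

Lemma VbE i j : Vb q 2 r%:Z i j = (i == j)%:R * q ^+ (r + j).
Proof. by rewrite mxE -PoszD. Qed.

Lemma VcE i j : Vc q 2 r%:Z i j = (i == j)%:R * gam j.
Proof.
rewrite mxE /gam /th; congr (_ * _).
case: j => -[|[|//]] H /=.
  have -> : (0%:Z + 1 - (r%:Z + 2%:Z))%R = - (r.+1)%:Z by clear; lia.
  by rewrite -exprnN exprS.
have -> : (1%:Z + 1 - (r%:Z + 2%:Z))%R = - r%:Z by clear; lia.
by rewrite -exprnN.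
Qed.

Lemma VdE i j : Vd q 2 i j = (i.+1 == j :> nat)%:R * (1 - q^-1).
Proof.
rewrite mxE; case: (eqVneq i.+1 (j : nat)) => [E|_]; last by rewrite !mul0r.
have -> : j = 1%N :> nat by case: j E => -[|[]].
congr (_ * _); rewrite /alpha expr1.
rewrite (_ : 1%:Z - 2%:Z = - 1%:Z :> int) // -exprnN expr1 mulrAC divff ?mul1r //.
by rewrite subr_eq0 (primitive_root_neq1 Hn Hq).
Qed.

Lemma rho_b k x y : @rho K 2 act k Gb x y = (x == y)%:R * th ^+ k * q ^+ ups (wd x).
Proof.
elim: k x y => [|k IH] x y.
  have -> : x = y by apply/ffunP => -[].
  by rewrite eqxx (size0nil (size_wd y)) /= !expr0 !mulr1.
rewrite /= /tens IH VbE wd_cons /=.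
have -> : (x == y) = (Defs.thead x == Defs.thead y) && (ttail x == ttail y).
  rewrite -(can_eq (@wdK _)) !wd_cons eqseq_cons (can_eq (@wdK _)).
  by rewrite -(can_eq eq1_ofb).
case: eqP => [<-|_]; last by rewrite !mul0r.
rewrite -mulrA; case: eqP => _; last by rewrite !(mul0r, mulr0).
rewrite !mul1r /th; case: (Defs.thead x) => -[|[|//]] H /=; rewrite ?addn0 ?addn1 ?add0n ?add1n !exprS; ring.
Qed.

Lemma rho_c k x y : @rho K 2 act k Gc x y = (x == y)%:R * (q * th)^-1 ^+ k * q ^+ ups (wd x).
Proof.
elim: k x y => [|k IH] x y.
  have -> : x = y by apply/ffunP => -[].
  by rewrite eqxx (size0nil (size_wd y)) /= !expr0 !mulr1.
rewrite /= /tens IH VcE wd_cons /=.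
have -> : (x == y) = (Defs.thead x == Defs.thead y) && (ttail x == ttail y).
  rewrite -(can_eq (@wdK _)) !wd_cons eqseq_cons (can_eq (@wdK _)).
  by rewrite -(can_eq eq1_ofb).
case: eqP => [<-|_]; last by rewrite !mul0r.
rewrite -mulrA; case: eqP => _; last by rewrite !(mul0r, mulr0).
rewrite !mul1r /gam; case: (Defs.thead x) => -[|[|//]] H /=; rewrite ?add0n ?add1n ?exprS //; field; by rewrite q0 th0.
Qed.

Lemma rho_a k f x :
  \sum_z @rho K 2 act k Ga x z * f (wd z) = raise q th 1 f (wd x).
Proof.
elim: k f x => [|k IH] f x.
  rewrite (size0nil (size_wd x)) /= big1 // => z _; exact: mul0r.
rewrite sum_tpbS wd_cons.
have E (b : bool) : \sum_(t : tpb 2 k) @rho K 2 act k.+1 Ga x (ofw k.+1 (b :: wd t)) *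
    f (wd (ofw k.+1 (b :: wd t)))
  = (Defs.thead x == (ofb b).+1 :> nat)%:R
    * (th ^+ k * q ^+ ups (wd (ttail x)) * f (b :: wd (ttail x)))
    + (Defs.thead x == ofb b)%:R * raise q th 1 (fun v => f (b :: v)) (wd (ttail x)).
  rewrite -IH -(sum_delta (ttail x) (fun t => _ * f (b :: wd t))) !mulr_sumr -big_split.
  apply: eq_bigr => t _ /=.
  rewrite /tens thead_ofw ttail_ofw wdK ofwK /= ?size_wd // rho_b !mxE.
  by ring.
rewrite big_bool /= !E /=; case: (Defs.thead x) => -[|[|//]] H /=.
  by rewrite !mul0r add0r mul1r !add0r.
by rewrite size_wd !mul0r !mul1r addr0 add0r addrC.
Qed.

Lemma rho_d k f y :
  \sum_z f (wd z) * @rho K 2 act k Gd z y = raise q (q * th)^-1 (1 - q^-1) f (wd y).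
Proof.
elim: k f y => [|k IH] f y.
  rewrite (size0nil (size_wd y)) /= big1 // => z _; exact: mulr0.
rewrite sum_tpbS wd_cons.
have E (b : bool) : \sum_(t : tpb 2 k) f (wd (ofw k.+1 (b :: wd t))) *
    @rho K 2 act k.+1 Gd (ofw k.+1 (b :: wd t)) y
  = ((ofb b).+1 == Defs.thead y :> nat)%:R * (1 - q^-1)
    * ((q * th)^-1 ^+ k * q ^+ ups (wd (ttail y)) * f (b :: wd (ttail y)))
    + (ofb b == Defs.thead y)%:R * raise q (q * th)^-1 (1 - q^-1) (fun v => f (b :: v)) (wd (ttail y)).
  rewrite -IH -(sum_delta (ttail y) (fun t => _ * f (b :: wd t))) !mulr_sumr -big_split.
  apply: eq_bigr => t _ /=.
  rewrite /tens thead_ofw ttail_ofw wdK ofwK /= ?size_wd // rho_c VdE mxE.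
  by rewrite (eq_sym t); case: (eqVneq (ttail y) t) => [->|_] /=; ring.
rewrite big_bool /= !E /=; case: (Defs.thead y) => -[|[|//]] H /=.
  by rewrite !mul0r add0r mul1r !add0r.
by rewrite size_wd /= !mul0r !mul1r add0r addr0 !mulrA addrC; congr (_ + _).
Qed.

Let e (a : 'I_2) : nat := (r + a)%N.

(** Orthogonality of characters: the sum over t is n when m = r + c modulo n and 0 otherwise. Thus
    the group-like part of the R-matrix is a power of c, with exponent the weight of b. *)
Lemma dft (c : 'I_2) (g : K) : g ^+ n = 1 ->
  \sum_(m < n) \sum_(t < n) q ^- (t * m) * (q ^+ e c) ^+ t * g ^+ m = n%:R * g ^+ e c.
Proof.
move=> Hg; have n1 : (0 < n)%N by lia.
pose m0 := Ordinal (ltn_pmod (e c) n1).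
rewrite (bigD1 m0) //= [X in _ + X]big1 => [|m Hm].
  rewrite addr0 (eq_bigr (fun=> g ^+ e c)) => [|t _].
    by rewrite sumr_const card_ord mulr_natl.
  rewrite -[in RHS](expr_mod _ Hg) -(expr_mod _ (prim_expr_order Hq)).
  rewrite modnMmr (expr_mod _ (prim_expr_order Hq)) mulnC exprM mulVf ?mul1r //.
  by rewrite !expf_neq0.
rewrite -mulr_suml (eq_bigr (fun t : 'I_n => (q ^- m * q ^+ e c) ^+ t)) => [|t _].
  rewrite sum_root_of_unity ?mul0r //.
    rewrite exprMn exprVn -!exprM ![(_ * n)%N]mulnC !exprM (prim_expr_order Hq).
    by rewrite !expr1n invr1 mul1r.
  apply: contra Hm => /eqP H; apply/eqP/val_inj => /=.
  have: q ^+ m == q ^+ e c.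
    by rewrite -[q ^+ e c]mul1r -(mulfV (expf_neq0 m q0)) -mulrA H mulr1.
  by rewrite (eq_prim_root_expr Hq) => /eqP <-; rewrite modn_small.
by rewrite mulnC exprM exprMn exprVn.
Qed.

Lemma gam_order c : gam c ^+ n = 1.
Proof.
rewrite /gam /th; case: ifP => _; rewrite exprVn ?exprMn -exprM mulnC exprM.
  by rewrite (prim_expr_order Hq) expr1n invr1.
by rewrite (prim_expr_order Hq) expr1n mulr1 invr1.
Qed.

Lemma Vb_pow t : Vb q 2 r%:Z ^+ t = \matrix_(i, j) ((i == j)%:R * (q ^+ e j) ^+ t).
Proof.
elim: t => [|t IH]; apply/matrixP => i j; first by rewrite !mxE mulr1.
rewrite exprS -mulmxE IH [LHS]mxE [RHS]mxE (bigD1 j) //= big1 => [|l Hl]; last by rewrite [in X in _ * X]mxE (negbTE Hl) mul0r mulr0.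
by rewrite addr0 VbE !mxE eqxx mul1r exprS mulrA.
Qed.

Lemma Vc_pow t : Vc q 2 r%:Z ^+ t = \matrix_(i, j) ((i == j)%:R * gam j ^+ t).
Proof.
elim: t => [|t IH]; apply/matrixP => i j; first by rewrite !mxE mulr1.
rewrite exprS -mulmxE IH [LHS]mxE [RHS]mxE (bigD1 j) //= big1 => [|l Hl]; last by rewrite [in X in _ * X]mxE (negbTE Hl) mul0r mulr0.
by rewrite addr0 VcE !mxE eqxx mul1r exprS mulrA.
Qed.

Lemma Va_sq : Va K 2 ^+ 2 = 0.
Proof.
apply/matrixP => i j; rewrite expr2 !mxE big1 // => l _; rewrite !mxE.
by case: i j l => -[|[|//]] ? [[|[|//]] ?] [[|[|//]] ?]; rewrite /= ?mul0r ?mulr0.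
Qed.

(** On V(2,r) the square of a is 0, so only the summands s = 0 and s = 1 survive; [dft] evaluates
    the sums over m and t. *)
Lemma RmatE (x1 x2 y1 y2 : 'I_2) : Rmat q n act x1 x2 y1 y2 =
  (x1 == y1)%:R * (x2 == y2)%:R * gam x2 ^+ e y1
  + (x1 == y1.+1 :> nat)%:R * (x2.+1 == y2 :> nat)%:R * (1 - q^-1) * gam x2 ^+ e y1.
Proof.
have E m s t : (act Ga ^+ s *m act Gb ^+ t) x1 y1 * (act Gc ^+ m *m act Gd ^+ s) x2 y2
   = (Va K 2 ^+ s) x1 y1 * (q ^+ e y1) ^+ t * (gam x2 ^+ m * (Vd q 2 ^+ s) x2 y2).
  congr (_ * _); rewrite mxE.
    rewrite (bigD1 y1) //= big1 => [|l Hl].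
      by rewrite Vb_pow mxE eqxx mul1r addr0.
    by rewrite Vb_pow mxE (negbTE Hl) mul0r mulr0.
  rewrite (bigD1 x2) //= big1 => [|l Hl].
    by rewrite Vc_pow mxE eqxx mul1r addr0.
  by rewrite Vc_pow mxE eq_sym (negbTE Hl) !mul0r.
rewrite /Rmat (eq_bigr (fun m : 'I_n => \sum_(s < n) (qfact q s)^-1 *
    (Va K 2 ^+ s) x1 y1 * (Vd q 2 ^+ s) x2 y2 *
    \sum_(t < n) q ^- (t * m) * (q ^+ e y1) ^+ t * gam x2 ^+ m)) => [|m _]; last first.
  apply: eq_bigr => s _; rewrite mulr_sumr; apply: eq_bigr => t _.
  by rewrite E; ring.
rewrite exchange_big /= (eq_bigr (fun s : 'I_n => (qfact q s)^-1 *
    (Va K 2 ^+ s) x1 y1 * (Vd q 2 ^+ s) x2 y2 * (n%:R * gam x2 ^+ e y1))) => [|s _]; last first.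
  by rewrite -mulr_sumr dft // gam_order.
rewrite -mulr_suml mulrCA mulKf //.
(* Because n is at least 2, both summands s = 0 and s = 1 occur. *)
case: n Hn => [|[|n']] // _.
rewrite !big_ord_recl big1 => [|s _].
  rewrite addr0 /= !expr0 !expr1 /qfact big_ord0 big_ord1 /qint big_ord1 expr0 invr1.
  by rewrite VdE !mxE; ring.
by rewrite /= !exprS mulrA -expr2 Va_sq mul0r mxE mulr0 !mul0r.
Qed.

(** The matrix of a generator on two neighbouring factors, with output letters a, b and input
    letters c, d. *)
Definition local_tl (a b c d : bool) : K :=
  if (a == b) || (c == d) then 0
  else if a then (if c then - qh else qh * th)
  else (if c then qh^-1 * th^-1 else - qh^-1).

Lemma local_tlE (a b c d : bool) :
  qh * (lam^-1 * Rcheck q n act (ofb a) (ofb b) (ofb c) (ofb d)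
        - ((a == c) && (b == d))%:R) = local_tl a b c d.
Proof.
have El : lam = (th ^+ r.+1)^-1 by rewrite /lam -exprnN exprM.
have Eg : (q * th) ^+ r = th ^+ r.+1 by rewrite exprMn -/th exprS.
rewrite /Rcheck RmatE /local_tl El /e /gam -Hqh.
have E1 : (qh ^+ 2 * th)^-1 ^+ r = (th * th ^+ r)^-1.
  by rewrite exprVn Hqh Eg exprS.
have A0 : th ^+ r != 0 by exact: expf_neq0.
case: a; case: b; case: c; case: d; rewrite /= ?addn0 ?addn1 ![_ ^+ r.+1]exprS ?E1 ?exprVn;
  by move: (th ^+ r) A0 => A A0; field; rewrite h0 th0 A0 oner_eq0.
Qed.

Local Notation T := (piT q n act qh lam).

Lemma piTE k (i : 'I_k.-1) (x z : tpb 2 k) P a b Q P' c d Q' :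
  wd x = P ++ a :: b :: Q -> wd z = P' ++ c :: d :: Q' ->
  size P = i -> size P' = i ->
  T i x z = local_tl a b c d * ((P == P') && (Q == Q'))%:R.
Proof.
move=> Ex Ez HP HP'.
rewrite /piT /Rcheck_i (prod_eq_outside K Ex Ez HP HP') -local_tlE /opid.
have -> : (x == z) = ((a == c) && (b == d)) && ((P == P') && (Q == Q')).
  rewrite -(can_eq (@wdK _)) Ex Ez eqseq_cat ?HP ?HP' // !eqseq_cons.
  by case: (P == P'); case: (a == c); case: (b == d); rewrite ?andbF.
rewrite !wd_letter Ex Ez !nth_cat /= HP HP' ltnn ltnNge leqnSn /= subnn subSnn.
by case: ((P == P') && (Q == Q')); rewrite ?andbT ?andbF /= ?mulr1 ?mulr0n ?mulr0 ?subr0 ?mulr0.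
Qed.

Lemma piT_rows k (i : 'I_k.-1) f (x : tpb 2 k) :
  \sum_z T i x z * f (wd z) = tlop th qh i f (wd x).
Proof.
have [P [a [b [Q [Ex HP]]]]] := split_at i x.
rewrite (@sum_local K k i (local_tl a b) _ f P Q HP).
- rewrite Ex -HP tlop_cat !big_bool /local_tl /=.
  by case: a b {Ex} => [] [] /=; ring.
- by have := size_wd x; rewrite Ex size_cat.
- by move=> z P' c d Q' Ez HP'; exact: piTE.
Qed.

(** Transposition swaps the off-diagonal entries [qh * th] and [qh^-1 * th^-1]; as [qh ^+ 2 = q],
    this amounts to replacing [th] by [(q * th)^-1]. *)
Lemma piT_cols k (i : 'I_k.-1) f (y : tpb 2 k) :
  \sum_z f (wd z) * T i z y = tlop (q * th)^-1 qh i f (wd y).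
Proof.
have [P [a [b [Q [Ey HP]]]]] := split_at i y.
rewrite (eq_bigr (fun z => T i z y * f (wd z))) => [|z _]; last exact: mulrC.
rewrite (@sum_local K k i (fun c d => local_tl c d a b) _ f P Q HP).
- rewrite Ey -HP tlop_cat !big_bool /local_tl /=.
  case: a b {Ey} => [] [] /=; rewrite -?Hqh; try ring.
  + by field; rewrite h0 th0 ?oner_eq0.
  + by field; rewrite h0 th0 ?oner_eq0.
- by have := size_wd y; rewrite Ey size_cat.
- move=> z P' c d Q' Ez HP'; rewrite (piTE Ez Ey HP' HP).
  by rewrite (eq_sym P') (eq_sym Q').
Qed.

End RMatrix.

(** * The ideal of relations *)

Section Ideal.
Variables (K : fieldType) (k : nat) (xi : K).
Implicit Types (p : ncpoly K k) (u v w : word k).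
Local Notation ideal := (@in_TLideal K k xi).

Lemma coef_nil w : coef (K := K) [::] w = 0.
Proof. by rewrite /coef big_nil. Qed.

Lemma coef_cons c u p w : coef ((c, u) :: p) w = (if u == w then c else 0) + coef p w.
Proof. by rewrite /coef big_cons. Qed.

Lemma coef_cat p p' w : coef (p ++ p') w = coef p w + coef p' w.
Proof. by rewrite /coef big_cat. Qed.

Lemma cat_ctx_eq u v x z : (u ++ x ++ v == u ++ z ++ v) = (x == z).
Proof.
apply/eqP/eqP => [|-> //] /(congr1 (drop (size u))); rewrite !drop_size_cat //.
move/(congr1 rev); rewrite !rev_cat => /(congr1 (drop (size (rev v)))).
by rewrite !drop_size_cat // => /(congr1 rev); rewrite !revK.
Qed.

(** The middle part z is read off from the lengths, and the test discards words with the wrong ends.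
    Hence the coefficients of a sandwich depend on p only through its coefficients, as
    [ideal_sandwich] requires. *)
Lemma coef_sandwich c u p v w : coef (sandwich c u p v) w =
  let z := take (size w - size u - size v) (drop (size u) w) in
  if u ++ z ++ v == w then c * coef p z else 0.
Proof.
rewrite /coef /sandwich big_map /=; set z := take _ _.
case: eqP => E.
  rewrite mulr_sumr; apply: eq_bigr => -[c' x] _ /=.
  by rewrite -E cat_ctx_eq; case: ifP; rewrite ?mulr0.
rewrite big1_seq // => -[c' x] _ /=; case: eqP => // E'; case: E.
rewrite -E' /z -E' drop_size_cat // !size_cat.
by rewrite addKn addnK take_size_cat.
Qed.

Lemma ideal_ext p p' : coef p =1 coef p' -> ideal p -> ideal p'.
Proof. by move=> E [gs [H1 H2]]; exists gs; split=> // w; rewrite -E. Qed.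

Lemma ideal_nil : ideal [::].
Proof. by exists [::]. Qed.

Lemma ideal_cat p p' : ideal p -> ideal p' -> ideal (p ++ p').
Proof.
move=> [gs [H1 H2]] [gs' [H1' H2']]; exists (gs ++ gs'); split.
  by move=> g; rewrite mem_cat => /orP[/H1|/H1'].
by move=> w; rewrite map_cat flatten_cat !coef_cat H2 H2'.
Qed.

Lemma sandwich_sandwich c u p v c' u' v' :
  sandwich c u (sandwich c' u' p v') v = sandwich (c * c') (u ++ u') p (v' ++ v).
Proof.
rewrite /sandwich -map_comp; apply: eq_map => x /=.
by rewrite mulrA !catA.
Qed.

Lemma ideal_sandwich c u p v : ideal p -> ideal (sandwich c u p v).
Proof.
move=> [gs [H1 H2]].
exists [seq (c * g.1.1.1, u ++ g.1.1.2, g.1.2, g.2 ++ v) | g <- gs]; split.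
  by move=> g /mapP[g' /H1 H ->].
move=> w; transitivity (coef (sandwich c u
    (flatten [seq sandwich g.1.1.1 g.1.1.2 g.1.2 g.2 | g <- gs]) v) w).
  by rewrite !coef_sandwich /= H2.
rewrite {1}/sandwich map_flatten -!map_comp; congr (coef (flatten _) w).
apply: eq_map => g /=; exact: sandwich_sandwich.
Qed.

Lemma ideal_relator p : is_TLrel xi p -> ideal p.
Proof.
move=> Hp; exists [:: (1, [::], p, [::])]; split.
  by move=> g; rewrite inE => /eqP ->.
move=> w; rewrite /= cats0 coef_sandwich /= subn0 drop0 subn0 take_size cats0 eqxx.
by rewrite mul1r.
Qed.

Definition ideal_eq u c v := ideal [:: (1, u); (- c, v)].

Lemma ideal_eq_trans u c v c' w :
  ideal_eq u c v -> ideal_eq v c' w -> ideal_eq u (c * c') w.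
Proof.
move=> H1 H2; apply: ideal_ext (ideal_cat H1 (ideal_sandwich c [::] [::] H2)).
move=> z; rewrite /sandwich /= !cats0 !coef_cons coef_nil.
by case: eqP; case: eqP; case: eqP => *; ring.
Qed.

Lemma ideal_eq_refl u : ideal_eq u 1 u.
Proof.
apply: ideal_ext ideal_nil => z; rewrite !coef_cons coef_nil.
by case: eqP => *; ring.
Qed.

Lemma ideal_eq_sym u v : ideal_eq u 1 v -> ideal_eq v 1 u.
Proof.
move=> H; apply: ideal_ext (ideal_sandwich (-1) [::] [::] H).
move=> z; rewrite /sandwich /= !cats0 !coef_cons coef_nil.
by case: eqP; case: eqP => *; ring.
Qed.

(** Letters out of range are dropped. This respects concatenation of arbitrary words, so
    [tlred_ideal] needs no range condition. *)
Definition of_letters (u : seq nat) : word k := pmap insub u.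

Lemma of_letters_cat (u v : seq nat) :
  of_letters (u ++ v) = of_letters u ++ of_letters v.
Proof. exact: pmap_cat. Qed.

Lemma of_lettersK u : of_letters (map val u) = u.
Proof. by rewrite /of_letters; elim: u => //= i u IH; rewrite valK /= IH. Qed.

Lemma of_letters1 (i : nat) (H : (i < k.-1)%N) : of_letters [:: i] = [:: Ordinal H].
Proof. by rewrite /of_letters /= insubT. Qed.

Lemma tlred_ideal (u : seq nat) c (v : seq nat) : tlred xi k.-1 u c v ->
  ideal_eq (of_letters u) c (of_letters v).
Proof.
elim=> {u c v} [u|u c v c' w _ H1 _ H2|u v _ H|a b u c v _ H|i j H|i H|i H|i H].
- exact: ideal_eq_refl.
- exact: ideal_eq_trans H1 H2.
- exact: ideal_eq_sym.
- rewrite !of_letters_cat.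
  apply: ideal_ext (ideal_sandwich 1 (of_letters a) (of_letters b) H) => z.
  by rewrite /sandwich /= !mul1r.
- have [H1 H2] := andP H; have H3 : (i < k.-1)%N by lia.
  rewrite -[[:: i; j]]/([:: i] ++ [:: j]) -[[:: j; i]]/([:: j] ++ [:: i]).
  rewrite !of_letters_cat !of_letters1; apply: ideal_relator; left.
  by exists (Ordinal H3), (Ordinal H2); split=> //; left.
- rewrite -[[:: i; i]]/([:: i] ++ [:: i]) of_letters_cat of_letters1.
  by apply: ideal_relator; right; right; exists (Ordinal H).
- have H3 : (i < k.-1)%N by lia.
  rewrite -[[:: i; i.+1; i]]/([:: i] ++ [:: i.+1] ++ [:: i]) !of_letters_cat !of_letters1.
  apply: ideal_relator; right; left.
  by exists (Ordinal H3), (Ordinal H); split=> //; right.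
- have H3 : (i < k.-1)%N by lia.
  rewrite -[[:: i.+1; i; i.+1]]/([:: i.+1] ++ [:: i] ++ [:: i.+1]) !of_letters_cat !of_letters1.
  pose a := Ordinal H3; pose b := Ordinal H; rewrite -/a -/b.
  have HA : ideal (rel_braidA K a b).
    by apply: ideal_relator; right; left; exists a, b; split=> //; left.
  have HB : ideal (rel_braidB K a b).
    by apply: ideal_relator; right; left; exists a, b; split=> //; right.
  (* The second cubic relation is the difference of the relators [rel_braidB] and [rel_braidA]. *)
  apply: ideal_ext (ideal_cat HB (ideal_sandwich (-1) [::] [::] HA)) => z.
  rewrite /sandwich /= !coef_cons coef_nil.
  by do 4! case: eqP => _; ring.
Qed.

End Ideal.

(** * Triangular systems of linear equations *)

Section Triangular.
Variables (K : fieldType) (I : finType) (good : pred I) (E : I -> I -> K) (rk : I -> nat).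
Hypothesis E_diag : forall i, good i -> E i i != 0.
Hypothesis E_tri : forall i j, good i -> E i j != 0 -> i = j \/ (rk j < rk i)%N.

(** Descending induction on the rank: equation i involves only c i and coefficients of strictly
    larger rank. The sum B of all ranks serves as an upper bound. *)
Lemma triangular_free (c : I -> K) :
  (forall j, good j -> \sum_(i | good i) c i * E i j = 0) ->
  forall i, good i -> c i = 0.
Proof.
move=> H; pose B := (\sum_i rk i)%N.
have HB i : (rk i <= B)%N by rewrite /B (bigD1 i) //= leq_addr.
suff: forall d i, good i -> (B - rk i < d)%N -> c i = 0.
  by move=> S i Hi; apply: (S (B - rk i).+1).
elim=> // d IH i Hi Hd; have := H i Hi; rewrite (bigD1 i) //= big1.
  by rewrite addr0 => /eqP; rewrite mulf_eq0 (negbTE (E_diag Hi)) orbF => /eqP.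
move=> j /andP[Hj Hji]; have [->|/(E_tri Hj) [E1|Hr]] := eqVneq (E j i) 0.
- by rewrite mulr0.
- by rewrite E1 eqxx in Hji.
- by rewrite IH ?mul0r //; have := HB i; have := HB j; lia.
Qed.

Lemma triangular_solve (g : I -> K) :
  exists c : I -> K, forall j, good j -> \sum_(i | good i) c i * E i j = g j.
Proof.
pose B := (\sum_i rk i)%N.
have HB i : (rk i <= B)%N by rewrite /B (bigD1 i) //= leq_addr.
suff [c Hc] : exists c : I -> K, forall j, good j -> (B - rk j < B.+1)%N ->
    \sum_(i | good i) c i * E i j = g j.
  by exists c => j Hj; apply: Hc => //; lia.
elim: B.+1 => [|d [c Hc]]; first by exists (fun=> 0).
(* Coefficients already found are kept. The new value solves equation i when i has the next rank,
   all other contributions then coming from larger ranks. *)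
pose c' i := if (B - rk i < d)%N then c i else
  (g i - \sum_(j | good j && (B - rk j < d)%N) c j * E j i) / E i i.
exists c' => j Hj Hd; have HBj := HB j.
rewrite (bigID (fun i => B - rk i < d)%N) /=.
rewrite (eq_bigr (fun i => c i * E i j)) => [|i /andP[_ Hi]]; last by rewrite /c' Hi.
have [Hjd|Hjd] := boolP (B - rk j < d)%N.
  rewrite [X in _ + X]big1 => [|i /andP[Hi Hid]].
    rewrite addr0 -[RHS](Hc j Hj Hjd) [RHS](bigID (fun i => B - rk i < d)%N) /=.
    rewrite [X in _ = _ + X]big1 ?addr0 // => i /andP[Hi Hid].
    have [->|/(E_tri Hi) [E1|Hr]] := eqVneq (E i j) 0; first by rewrite mulr0.
      by rewrite E1 Hjd in Hid.
    by have := HB i; lia.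
  have [->|/(E_tri Hi) [E1|Hr]] := eqVneq (E i j) 0; first by rewrite mulr0.
    by rewrite E1 Hjd in Hid.
  by have := HB i; lia.
rewrite [X in _ + X](bigD1 j) ?Hj ?Hjd //= [X in _ + (_ + X)]big1.
  by rewrite addr0 /c' (negbTE Hjd) divfK ?E_diag // addrC subrK.
move=> i /andP[/andP[Hi Hid] Hij].
have [->|/(E_tri Hi) [E1|Hr]] := eqVneq (E i j) 0; first by rewrite mulr0.
  by rewrite E1 eqxx in Hij.
by have := HB i; lia.
Qed.

End Triangular.

(** * Dominance and linear independence *)

Section Dominance.

(** Dominance order: the path w stays weakly below the path S. *)
Definition dom (w S : seq bool) : Prop :=
  size w = size S /\ forall j, (ups (take j w) <= ups (take j S))%N.

Definition prefix_weight (w : seq bool) : nat :=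
  \sum_(j < (size w).+1) ups (take j w).

Lemma ups_take_nth j (w : seq bool) : (j < size w)%N ->
  ups (take j.+1 w) = (ups (take j w) + nth false w j)%N.
Proof. by move=> H; rewrite (take_nth false) // -cats1 count_cat /= addn0. Qed.

Lemma dom_lt w S : dom w S -> w = S \/ (prefix_weight w < prefix_weight S)%N.
Proof.
move=> [Hs Hd].
case: (pickP (fun j : 'I_(size w).+1 => ups (take j w) < ups (take j S))%N) => [j Hj|H].
  right; rewrite /prefix_weight -Hs (bigD1 j) //= [X in (_ < X)%N](bigD1 j) //=.
  by rewrite -addSn leq_add // leq_sum.
have E j : (j <= size w)%N -> ups (take j w) = ups (take j S).
  move=> Hj; apply/eqP; rewrite eqn_leq Hd leqNgt.
  by have /= -> := H (Ordinal (Hj : j < (size w).+1)%N).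
left; apply: (@eq_from_nth _ false) => // j Hj.
have := E j.+1 Hj; rewrite !ups_take_nth -?Hs // E 1?ltnW // => /addnI.
by case: nth; case: nth.
Qed.

Lemma ups_take_cat2 j (P Q : seq bool) a b :
  ups (take j (P ++ a :: b :: Q)) =
    if (j <= size P)%N then ups (take j P)
    else if j == (size P).+1 then (ups P + a)%N
    else (ups P + (a + b + ups (take (j - (size P).+2) Q)))%N.
Proof.
rewrite take_cat; case: ltngtP => [//|H|->]; last by rewrite subnn take0 cats0 take_size.
case: eqP => [->|H']; first by rewrite subSnn /= count_cat /= addn0.
have -> : (j - size P = (j - (size P).+2).+2)%N by lia.
by rewrite count_cat /= !addnA.
Qed.

Variables (K : fieldType) (theta h : K).

(** Valley and peak differ only in the prefix of length [(size P).+1], where the peak allows the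
    largest possible count. The peak word itself is not below the valley, so f vanishes there and
    only the exchanged term remains. *)
Lemma dom_box f P Q :
  (forall w, size w = (size P + (size Q).+2)%N -> f w != 0 ->
     dom w (P ++ false :: true :: Q)) ->
  (forall w, size w = (size P + (size Q).+2)%N -> tlop theta h (size P) f w != 0 ->
     dom w (P ++ true :: false :: Q)) /\
  tlop theta h (size P) f (P ++ true :: false :: Q) =
    h * theta * f (P ++ false :: true :: Q).
Proof.
move=> H; split; last first.
  rewrite tlop_cat /=.
  suff -> : f (P ++ true :: false :: Q) = 0 by rewrite subr0 mulrA.
  apply/eqP; apply: contraT => /H [|_ /(_ (size P).+1)]; first by rewrite size_cat.
  by rewrite !ups_take_cat2 ltnn eqxx; lia.
move=> w Hw.
have [P' [a [b [Q' [Ew HP]]]]] : exists P' a b Q', w = P' ++ a :: b :: Q' /\ size P' = size P.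
  by apply: cat_cons2; lia.
move: Hw; rewrite Ew -HP tlop_cat size_cat /= HP => Hw.
case: (eqVneq a b) => [_|Hab]; first by rewrite eqxx.
move=> Hf.
(* The value of [tlop] combines f at w and at w with the two letters exchanged, so f is nonzero at
   one of them. *)
have [c [d [Hcd Hc]]] : exists c d : bool, (c + d = 1)%N /\ f (P' ++ c :: d :: Q') != 0.
  have [E|] := eqVneq (f (P' ++ a :: b :: Q')) 0; last first.
    by exists a, b; split=> //; move: Hab; case: (a); case: (b).
  exists b, a; split; first by move: Hab; case: (a); case: (b).
  apply: contraNneq Hf => E'; rewrite E E' !mulr0 subr0 !mulr0.
  by case: (a).
have [|Hs Hd] := H _ _ Hc; first by rewrite size_cat /= HP.
split; first by move: Hs; rewrite !size_cat.
move=> j; have := Hd j; have := Hd (size P); rewrite !ups_take_cat2 HP leqnn !take_size -{1}HP take_size.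
case: ifP => // _; case: eqP => [_|_] /=; last by rewrite Hcd; move: Hab; case: (a); case: (b) => //=; lia.
by move=> + _; case: (a) => /=; lia.
Qed.

Lemma cups_cons n : cups n.+1 = 0%N :: map (addn 2) (cups n).
Proof.
elim: n => // n IH; rewrite -[LHS]/(rcons (cups n.+1) n.+1.*2) {1}IH.
by rewrite [cups n.+1]/= map_rcons doubleS rcons_cons.
Qed.

Lemma foldr_tlop_ext u f f' w : (forall v, size v = size w -> f v = f' v) ->
  foldr (tlop theta h) f u w = foldr (tlop theta h) f' u w.
Proof.
elim: u w => [|i u IH] w H /=; first exact: H.
by apply: tlop_ext => v Hv _; apply: IH => z Hz; apply: H; rewrite Hz.
Qed.

Lemma foldr_tlop_scale c u f w :
  foldr (tlop theta h) (fun v => c * f v) u w = c * foldr (tlop theta h) f u w.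
Proof.
elim: u w => //= i u IH w.
rewrite -(tlop_weight _ _ _ (fun _ _ => c)).
by apply: tlop_ext => v _ _; exact: IH.
Qed.

Lemma foldr_tlop_shift u f a b w :
  foldr (tlop theta h) f (map (addn 2) u) (a :: b :: w) =
  foldr (tlop theta h) (fun v => f (a :: b :: v)) u w.
Proof.
elim: u w => //= i u IH w.
by apply: tlop_ext => v _ _; exact: IH.
Qed.

Lemma dom_cons2 a b w S : a != b -> dom w S ->
  dom (a :: b :: w) (true :: false :: S).
Proof.
move=> Hab [Hs Hd]; split; first by rewrite /= Hs.
move=> [|[|j]] //=; first by case: (a).
by have := Hd j; move: Hab; case: (a); case: (b) => //=; lia.
Qed.

(** A nonzero entry needs two distinct letters in each of the first n pairs, on both sides; such
    words lie below the zigzag. *)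
Lemma dom_cups n p x y : size x = (n.*2 + p)%N -> size y = (n.*2 + p)%N ->
  foldr (tlop theta h) (fun v => (v == y)%:R) (cups n) x != 0 ->
  dom x (zigzag n p) /\ dom y (zigzag n p).
Proof.
elim: n x y => [|n IH] x y Hx Hy.
  suff D w : size w = p -> dom w (zigzag 0 p) by move=> _; split; apply: D.
  move=> Hw; split; first by rewrite size_nseq.
  move=> j; have -> : ups (take j (zigzag 0 p)) = minn j p.
    rewrite /zigzag /=; case: (leqP j p) => Hj; [rewrite take_nseq // | rewrite take_oversize ?size_nseq; try lia];
    by rewrite count_nseq mul1n; lia.
  apply: leq_trans (count_size _ _) _; rewrite size_take Hw; case: ltnP; lia.
case: x Hx => [|a [|b x]] //; case: y Hy => [|c [|d y]] //.
rewrite doubleS !addSn => -[Hy] [Hx]; rewrite cups_cons.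
pose G := foldr (tlop theta h) (fun v => (v == y)%:R) (cups n) x.
have E a' b' : foldr (tlop theta h) (fun v => (v == c :: d :: y)%:R)
    (map (addn 2) (cups n)) (a' :: b' :: x) = ((a' == c) && (b' == d))%:R * G.
  rewrite foldr_tlop_shift -foldr_tlop_scale; apply: foldr_tlop_ext => v _.
  by rewrite !eqseq_cons andbA; case: ((a' == c) && (b' == d)); rewrite /= ?mul1r ?mul0r.
rewrite [foldr _ _ _ _]/= !E.
case: (eqVneq a b) => [_|Hab]; first by rewrite eqxx.
have [G0|/(IH _ _ Hx Hy) [H1 H2]] := eqVneq G 0.
  by rewrite G0 !(mulr0, subr0); case: (a); rewrite eqxx.
case: (eqVneq c d) => [<-|Hcd] Hne; last by split; exact: dom_cons2.
move: Hne; have -> : ((b == c) && (a == c)) = false.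
  by move: Hab; case: (a); case: (b); case: (c).
have -> : ((a == c) && (b == c)) = false.
  by move: Hab; case: (a); case: (b); case: (c).
by rewrite !(mul0r, mulr0, subr0); case: (a); rewrite eqxx.
Qed.

Hypothesis h0 : h != 0.

(** Each cup contributes the diagonal entry [- h]. *)
Lemma cups_diag n p :
  foldr (tlop theta h) (fun v => (v == zigzag n p)%:R) (cups n) (zigzag n p) != 0.
Proof.
elim: n => [|n IH]; first by rewrite /= eqxx oner_eq0.
have E a b : foldr (tlop theta h) (fun v => (v == zigzag n.+1 p)%:R)
    (map (addn 2) (cups n)) (a :: b :: zigzag n p) = (a && ~~ b)%:R *
  foldr (tlop theta h) (fun v => (v == zigzag n p)%:R) (cups n) (zigzag n p).
  rewrite foldr_tlop_shift -foldr_tlop_scale; apply: foldr_tlop_ext => v _.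
  rewrite -[zigzag n.+1 p]/(true :: false :: zigzag n p) !eqseq_cons andbA.
  by case: a; case: b; rewrite /= ?mul1r ?mul0r.
rewrite cups_cons -[X in foldr _ _ _ X]/(true :: false :: zigzag n p) [foldr _ _ _ _]/= !E /=.
by rewrite mul0r mulr0 mul1r sub0r mulrN oppr_eq0 mulf_neq0.
Qed.

Hypothesis th0 : theta != 0.

(** Rewriting of words is sound for the operators; the length m + 1 is what the two cubic relations
    need. *)
Lemma tlred_eval m u c v f w : tlred (- (h + h^-1)) m u c v -> size w = m.+1 ->
  foldr (tlop theta h) f u w = c * foldr (tlop theta h) f v w.
Proof.
move=> H; elim: H f w => {u c v}
  [u|u c v c' z _ H1 _ H2|u v _ H|a b u c v _ H|i j H|i H|i H|i H] f w Hw.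
- by rewrite mul1r.
- by rewrite H1 // H2 // mulrA.
- by rewrite mul1r H // mul1r.
- rewrite !foldr_cat -foldr_tlop_scale; apply: foldr_tlop_ext => x Hx.
  by rewrite H ?Hx.
- by rewrite mul1r /= tlop_comm //; case/andP: H.
- by rewrite /= tlop_sq.
- by rewrite mul1r /= tlop_braid1 // Hw.
- by rewrite mul1r; apply: tlop_braid2; rewrite // Hw.
Qed.

End Dominance.

(** * Products of operators and closure properties of the commutant *)

Section OpAlgebra.
Variables (K : fieldType) (l k : nat).
Implicit Types M N L : op K l k.

Lemma opmul_ext M M' N N' x y : (forall x y, M x y = M' x y) ->
  (forall x y, N x y = N' x y) -> opmul M N x y = opmul M' N' x y.
Proof. by move=> H H'; apply: eq_bigr => z _; rewrite H H'. Qed.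

Lemma opmulA M N L x y : opmul M (opmul N L) x y = opmul (opmul M N) L x y.
Proof.
rewrite /opmul (eq_bigr (fun z => \sum_t M x z * N z t * L t y)).
  by rewrite exchange_big /=; apply: eq_bigr => t _; rewrite mulr_suml.
by move=> z _; rewrite mulr_sumr; apply: eq_bigr => t _; rewrite mulrA.
Qed.

Lemma opmul1 M x y : opmul M (@opid K l k) x y = M x y.
Proof.
rewrite /opmul -(sum_delta y (fun z => M x z)).
by apply: eq_bigr => z _; rewrite /opid eq_sym mulrC.
Qed.

Lemma opmul_id M x y : opmul (@opid K l k) M x y = M x y.
Proof. exact: sum_delta. Qed.

Variable T : 'I_k.-1 -> op K l k.

Lemma evword_cat u v x y :
  evword T (u ++ v) x y = opmul (evword T u) (evword T v) x y.
Proof.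
elim: u x y => [|i u IH] x y /=; first by rewrite opmul_id.
by rewrite -opmulA; apply: opmul_ext.
Qed.

Lemma evword_rcons u i x y :
  evword T (rcons u i) x y = opmul (evword T u) (T i) x y.
Proof.
rewrite -cats1 evword_cat; apply: opmul_ext => // z t.
exact: opmul1.
Qed.

Variable G : gen -> op K l k.

Lemma commutant_evword u : (forall i, commutant G (T i)) -> commutant G (evword T u).
Proof.
move=> H; elim: u => [|i u IH] g x y /=; first by rewrite opmul1 opmul_id.
rewrite -opmulA.
transitivity (opmul (T i) (opmul (G g) (evword T u)) x y).
  by apply: opmul_ext => // z t; exact: IH.
rewrite opmulA.
transitivity (opmul (opmul (G g) (T i)) (evword T u) x y).
  by apply: opmul_ext => // z t; exact: H.
by rewrite opmulA.
Qed.

Lemma opmul_evpolyl p M x y :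
  opmul (evpoly T p) M x y = \sum_(t <- p) t.1 * opmul (evword T t.2) M x y.
Proof.
rewrite /opmul /evpoly (eq_bigr (fun z => \sum_(t <- p) t.1 * (evword T t.2 x z * M z y))).
  by rewrite exchange_big; apply: eq_bigr => t _; rewrite mulr_sumr.
by move=> z _; rewrite mulr_suml; apply: eq_bigr => t _; rewrite mulrA.
Qed.

Lemma opmul_evpolyr p M x y :
  opmul M (evpoly T p) x y = \sum_(t <- p) t.1 * opmul M (evword T t.2) x y.
Proof.
rewrite /opmul /evpoly (eq_bigr (fun z => \sum_(t <- p) t.1 * (M x z * evword T t.2 z y))).
  by rewrite exchange_big; apply: eq_bigr => t _; rewrite mulr_sumr.
by move=> z _; rewrite mulr_sumr; apply: eq_bigr => t _; rewrite mulrCA.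
Qed.

Lemma commutant_evpoly p : (forall i, commutant G (T i)) -> commutant G (evpoly T p).
Proof.
move=> H g x y; rewrite opmul_evpolyl opmul_evpolyr.
by apply: eq_bigr => t _; rewrite commutant_evword.
Qed.

Lemma commutant_sub M N : commutant G M -> commutant G N ->
  commutant G (fun x y => M x y - N x y).
Proof.
move=> HM HN g x y; rewrite /opmul.
under eq_bigr do rewrite mulrBl.
under [RHS]eq_bigr do rewrite mulrBr.
by rewrite !sumrB; congr (_ - _); [exact: HM | exact: HN].
Qed.

End OpAlgebra.

(** * The commutant *)

Section Main.
Variables (K : fieldType) (n : nat) (q qh : K) (r k : nat).
Hypotheses (Hn : (2 <= n)%N) (Hq : n.-primitive_root q) (n0 : n%:R != 0 :> K).
Hypotheses (Hqh : qh ^+ 2 = q) (Hk1 : (1 <= k)%N) (Hk2 : (k <= 2 * n - 2)%N).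

Let act := Vact q 2 r%:Z.
Let th := q ^+ r.
Let th' := (q * th)^-1.
Let lam := q ^ (- (r * r.+1)%:Z).
Let xi := - (qh + qh^-1).
Let q0 : q != 0 := primitive_root_neq0 Hq.
Let th0 : th != 0. Proof. exact: expf_neq0. Qed.
Let th'0 : th' != 0. Proof. by rewrite invr_neq0 ?mulf_neq0. Qed.
Let h0 : qh != 0. Proof. by apply: contraNneq q0 => E; rewrite -Hqh E expr0n. Qed.

Local Notation T := (@piT K q n 2 k act qh lam).
Local Notation G := (@rho K 2 act k).
Local Notation delta y := (fun v : seq bool => (v == wd y)%:R : K).
Implicit Types (M : op K 2 k) (x y z : tpb 2 k).

Lemma mul_T_rows i M x y :
  opmul (T i) M x y = tlop th qh i (fun s => M (ofw k s) y) (wd x).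
Proof.
rewrite -(piT_rows Hn Hq n0 r Hqh) /opmul; apply: eq_bigr => z _.
by rewrite wdK.
Qed.

Lemma mul_T_cols i M x y :
  opmul M (T i) x y = tlop th' qh i (fun s => M x (ofw k s)) (wd y).
Proof.
rewrite -(piT_cols Hn Hq n0 r Hqh) /opmul; apply: eq_bigr => z _.
by rewrite wdK.
Qed.

Lemma mul_a_rows M x y :
  opmul (G Ga) M x y = raise q th 1 (fun s => M (ofw k s) y) (wd x).
Proof.
rewrite -(rho_a q r) /opmul; apply: eq_bigr => z _.
by rewrite wdK.
Qed.

Lemma mul_d_cols M x y :
  opmul M (G Gd) x y = raise q th' (1 - q^-1) (fun s => M x (ofw k s)) (wd y).
Proof.
rewrite -(rho_d Hn Hq r) /opmul; apply: eq_bigr => z _.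
by rewrite wdK.
Qed.

Lemma opid_wd x y : @opid K 2 k x y = (wd x == wd y)%:R.
Proof. by rewrite /opid (can_eq (@wdK _)). Qed.

Lemma eq_ofw s y : size s = k -> (ofw k s == y) = (s == wd y).
Proof. by move=> Hs; rewrite -(can_eq (@wdK _)) ofwK. Qed.

Lemma T_rows i x y : T i x y = tlop th qh i (delta y) (wd x).
Proof.
rewrite -[LHS]opmul1 mul_T_rows; apply: tlop_ext => v Hv _.
by rewrite /opid eq_ofw // Hv size_wd.
Qed.

Lemma T_cols i x y : T i x y = tlop th' qh i (delta x) (wd y).
Proof.
rewrite -[LHS]opmul_id mul_T_cols; apply: tlop_ext => v Hv _.
by rewrite /opid eq_sym eq_ofw // Hv size_wd.
Qed.

Lemma a_rows x y : G Ga x y = raise q th 1 (delta y) (wd x).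
Proof.
rewrite -[LHS]opmul1 mul_a_rows; apply: raise_ext => v Hv.
by rewrite /opid eq_ofw // Hv size_wd.
Qed.

Lemma d_cols x y : G Gd x y = raise q th' (1 - q^-1) (delta x) (wd y).
Proof.
rewrite -[LHS]opmul_id mul_d_cols; apply: raise_ext => v Hv.
by rewrite /opid eq_sym eq_ofw // Hv size_wd.
Qed.

Lemma diag_mul (b : nat -> K) M D x y : (forall x y, D x y = (x == y)%:R * b (ups (wd x))) ->
  opmul M D x y = M x y * b (ups (wd y)) /\ opmul D M x y = b (ups (wd x)) * M x y.
Proof.
move=> HD; split; rewrite /opmul.
  rewrite -(sum_delta y (fun z => M x z * b (ups (wd z)))).
  by apply: eq_bigr => z _; rewrite HD eq_sym mulrCA.
rewrite -(sum_delta x (fun z => b (ups (wd x)) * M z y)).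
by apply: eq_bigr => z _; rewrite HD mulrA.
Qed.

Lemma T_weight i (b : nat -> K) x y :
  T i x y * b (ups (wd y)) = b (ups (wd x)) * T i x y.
Proof.
rewrite T_rows -(tlop_weight _ _ _ (fun _ => b)).
rewrite mulrC -(tlop_weight _ _ _ (fun _ _ => b (ups (wd y)))).
apply: tlop_ext => v _ _; case: (eqVneq v (wd y)) => [->|_] //=.
by rewrite !mulr0.
Qed.

Lemma rho_bE x y : G Gb x y = (x == y)%:R * (th ^+ k * q ^+ ups (wd x)).
Proof. by rewrite rho_b mulrA. Qed.

Lemma rho_cE x y : G Gc x y = (x == y)%:R * (th' ^+ k * q ^+ ups (wd x)).
Proof. by rewrite (rho_c Hq) mulrA. Qed.

(** For a one looks at columns, for d at rows, and both reduce to [raise_tlop]; b and c are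
    functions of the weight, which T i preserves. *)
Lemma T_commutant i : commutant G (T i).
Proof.
case=> x y.
- rewrite mul_T_rows mul_a_rows.
  rewrite (tlop_ext _ _ _ (f' := raise q th 1 (delta y))).
    rewrite -raise_tlop //; apply: raise_ext => v Hv.
    by rewrite T_rows ofwK // Hv size_wd.
  by move=> v Hv _; rewrite a_rows ofwK // Hv size_wd.
- have [-> ->] := @diag_mul (fun m => th ^+ k * q ^+ m) (T i) _ x y rho_bE.
  exact: (T_weight i (fun m => th ^+ k * q ^+ m)).
- have [-> ->] := @diag_mul (fun m => th' ^+ k * q ^+ m) (T i) _ x y rho_cE.
  exact: (T_weight i (fun m => th' ^+ k * q ^+ m)).
- rewrite mul_T_cols mul_d_cols.
  rewrite [RHS](tlop_ext _ _ _ (f' := raise q th' (1 - q^-1) (delta x))).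
    rewrite -raise_tlop //; apply: raise_ext => v Hv.
    by rewrite T_cols ofwK // Hv size_wd.
  by move=> v Hv _; rewrite d_cols ofwK // Hv size_wd.
Qed.

Lemma evword_rows u x y :
  evword T u x y = foldr (tlop th qh) (delta y) (map val u) (wd x).
Proof.
elim: u x => [|i u IH] x /=; first exact: opid_wd.
rewrite mul_T_rows; apply: tlop_ext => v Hv _.
by rewrite IH ofwK // Hv size_wd.
Qed.

Lemma tlred_evword u c v x y : tlred xi k.-1 (map val u) c (map val v) ->
  evword T u x y = c * evword T v x y.
Proof.
move=> H; rewrite !evword_rows; apply: (tlred_eval h0 th0) H _.
by rewrite size_wd prednK.
Qed.

Lemma T_relator p x y : is_TLrel xi p -> evpoly T p x y = 0.
Proof.
rewrite /evpoly; case=> [[i [j [Hij ->]]]|[[i [i' [Hi Hp]]]|[i ->]]].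
- have E : evword T [:: i; j] x y = 1 * evword T [:: j; i] x y.
    apply: tlred_evword => /=; case: Hij => Hij; last apply: tlred_sym;
      by apply: tlred_comm; rewrite Hij ltn_ord.
  by rewrite !big_cons big_nil E /=; ring.
- have H : (i.+1 < k.-1)%N by rewrite -Hi ltn_ord.
  have E1 : evword T [:: i; i'; i] x y = 1 * evword T [:: i] x y.
    by apply: tlred_evword; rewrite /= Hi; exact: tlred_braid1.
  have E2 : evword T [:: i'; i; i'] x y = 1 * evword T [:: i'] x y.
    by apply: tlred_evword; rewrite /= Hi; exact: tlred_braid2.
  by case: Hp => ->; rewrite !big_cons big_nil ?E2 ?E1 /=; ring.
- have E : evword T [:: i; i] x y = xi * evword T [:: i] x y.
    by apply: tlred_evword; apply: tlred_sq; exact: ltn_ord.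
  by rewrite !big_cons big_nil E /=; ring.
Qed.

(** * The commutant is determined by pairs of ballot words *)

Definition same_weight_ballots (I : tpb 2 k * tpb 2 k) : bool :=
  [&& ballot 0 (wd I.1), ballot 0 (wd I.2) & ups (wd I.1) == ups (wd I.2)].

(** The alternative required by [ballot_determines] at height 0: if i is at least n - 1, then n + i
    is at least 2n - 1, which exceeds k. *)
Lemma weight_bound i : (k < n + i)%N || (i + 1 < n)%N.
Proof. by lia. Qed.

Lemma column_determined M y i :
    (forall x, ups (wd x) = i.+1 -> opmul (G Ga) M x y = 0) ->
    (forall x, ups (wd x) = i -> ballot 0 (wd x) -> M x y = 0) ->
  forall x, ups (wd x) = i -> M x y = 0.
Proof.
move=> Ha Hb x Hx.
(* The column is cut down to weight i, since only rows of weight i + 1 of the product with a are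
   known to vanish. *)
pose f s := if ups s == i then M (ofw k s) y else 0.
suff: f (wd x) = 0 by rewrite /f Hx eqxx wdK.
apply: (@ballot_determines _ q th 1 n k 0 i f Hq th0 (oner_neq0 _)) (size_wd x) => //.
- by move=> w _ /eqP Hw; rewrite /f (negbTE Hw).
- move=> w Hw /=; have [Hi|/eqP Hi] := eqVneq (ups w) i.+1; last first.
    by apply: (@raise_supp _ _ _ _ _ _ i) Hi => v _ /eqP Hv; rewrite /f (negbTE Hv).
  rewrite -[RHS](Ha (ofw k w)) ?ofwK // mul_a_rows ofwK //.
  apply: raise_ext_ups => v _; rewrite Hi => -[Hv].
  by rewrite /f Hv eqxx.
- exact: weight_bound.
- move=> w Hw Hbw; rewrite /f; case: eqP => // Hi.
  by apply: Hb; rewrite ofwK.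
Qed.

Lemma row_determined M x j :
    (forall y, ups (wd y) = j.+1 -> opmul M (G Gd) x y = 0) ->
    (forall y, ups (wd y) = j -> ballot 0 (wd y) -> M x y = 0) ->
  forall y, ups (wd y) = j -> M x y = 0.
Proof.
move=> Hd Hb y Hy.
pose f s := if ups s == j then M x (ofw k s) else 0.
suff: f (wd y) = 0 by rewrite /f Hy eqxx wdK.
have g0 : 1 - q^-1 != 0.
  by rewrite subr_eq0 eq_sym invr_eq1 (primitive_root_neq1 Hn Hq).
apply: (@ballot_determines _ q th' _ n k 0 j f Hq th'0 g0) (size_wd y) => //.
- by move=> w _ /eqP Hw; rewrite /f (negbTE Hw).
- move=> w Hw /=; have [Hi|/eqP Hi] := eqVneq (ups w) j.+1; last first.
    by apply: (@raise_supp _ _ _ _ _ _ j) Hi => v _ /eqP Hv; rewrite /f (negbTE Hv).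
  rewrite -[RHS](Hd (ofw k w)) ?ofwK // mul_d_cols ofwK //.
  apply: raise_ext_ups => v _; rewrite Hi => -[Hv].
  by rewrite /f Hv eqxx.
- exact: weight_bound.
- move=> w Hw Hbw; rewrite /f; case: eqP => // Hi.
  by apply: Hb; rewrite ofwK.
Qed.

Lemma commutant_zero M : commutant G M ->
  (forall x y, same_weight_ballots (x, y) -> M x y = 0) -> forall x y, M x y = 0.
Proof.
(* Descending induction on the total weight of x and y, which is at most 2k. *)
move=> HM Hg; suff: forall d x y, (2 * k < ups (wd x) + ups (wd y) + d)%N -> M x y = 0.
  by move=> H x y; apply: (H (2 * k).+1); lia.
elim=> [|d IH] x y Hd.
  have := count_size id (wd x); have := count_size id (wd y).
  by rewrite !size_wd; lia.
have Hu z : (ups (wd z) <= k)%N by rewrite -[X in (_ <= X)%N](size_wd z) count_size.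
have Hdelta z v : size v = k -> ups v <> ups (wd z) -> delta z v = 0.
  by move=> _ Hv; case: eqP => // E; case: Hv; rewrite E.
(* After commuting, the product M a involves only entries of M whose row and column weights are both
   one higher; these vanish by induction. *)
have Hcol x' y' : ups (wd x') = (ups (wd x)).+1 -> ups (wd y') = ups (wd y) ->
    opmul (G Ga) M x' y' = 0.
  move=> Hx' Hy'; rewrite -HM /opmul big1 // => z _; rewrite a_rows.
  have [Hz|/eqP Hz] := eqVneq (ups (wd z)) (ups (wd y')).+1.
    by rewrite IH ?mul0r // Hx' Hz Hy'; lia.
  rewrite (@raise_supp _ _ _ _ _ _ (ups (wd y'))) ?mulr0 // => v Hv.
  by apply: Hdelta; rewrite Hv size_wd.
have Hrow x' y' : ups (wd x') = ups (wd x) -> ups (wd y') = (ups (wd y)).+1 ->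
    opmul M (G Gd) x' y' = 0.
  move=> Hx' Hy'; rewrite HM /opmul big1 // => z _; rewrite d_cols.
  have [Hz|/eqP Hz] := eqVneq (ups (wd z)) (ups (wd x')).+1.
    by rewrite IH ?mulr0 // Hz Hx' Hy'; lia.
  rewrite (@raise_supp _ _ _ _ _ _ (ups (wd x'))) ?mul0r // => v Hv.
  by apply: Hdelta; rewrite Hv size_wd.
have Hbal z : ballot 0 (wd z) -> (k <= 2 * ups (wd z))%N.
  by move/ballot_size; rewrite size_wd.
have Hmod : M x y != 0 -> ups (wd x) = ups (wd y) %[mod n].
  move=> HM0; have [E1 E2] := @diag_mul (fun m => th ^+ k * q ^+ m) M _ x y rho_bE.
  have := HM Gb x y; rewrite E1 E2 mulrC => /(mulIf HM0) /mulfI.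
  rewrite expf_neq0 // => /(_ isT) /eqP.
  by rewrite (eq_prim_root_expr Hq) => /eqP.
have [//|HM0] := eqVneq (M x y) 0; have {}Hmod := Hmod HM0.
(* Congruence gives a + n <= b <= k, so 2a <= 2k - 2n <= k - 2. By [Hbal] no ballot word has such a
   weight. *)
have far a b : (a < b)%N -> (b <= k)%N -> a = b %[mod n] -> (2 * a < k)%N.
  move=> ab bk /eqP; rewrite eq_sym eqn_mod_dvd; last exact: ltnW.
  by move/dvdn_leq; lia.
case: (ltngtP (ups (wd x)) (ups (wd y))) => Hxy.
- apply: (column_determined (i := ups (wd x))) => // [x' Hx'|x' Hx' /Hbal].
    exact: Hcol.
  by rewrite Hx'; have := far _ _ Hxy (Hu y) Hmod; lia.
- apply: (row_determined (j := ups (wd y))) => // [y' Hy'|y' Hy' /Hbal].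
    exact: Hrow.
  by rewrite Hy'; have := far _ _ Hxy (Hu x) (esym Hmod); lia.
(* For equal weights, first the row index is reduced to a ballot word, then the column index. *)
- apply: (column_determined (i := ups (wd x))) => // [x' Hx'|x' Hx' Hbx].
    exact: Hcol.
  apply: (row_determined (j := ups (wd y))) => // [y' Hy'|y' Hy' Hby].
    exact: Hrow.
  by apply: Hg; rewrite /same_weight_ballots /= Hbx Hby Hx' Hy' Hxy eqxx.
Qed.


(** * Leading entries of normal words *)

Definition leading M S S' :=
  (forall x y, M x y != 0 -> dom (wd x) S /\ dom (wd y) S') /\
  M (ofw k S) (ofw k S') != 0.

Lemma leading_ext M M' S S' :
  (forall x y, M x y = M' x y) -> leading M S S' -> leading M' S S'.
Proof. by move=> E [H1 H2]; split=> [x y|]; rewrite -E //; exact: H1. Qed.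

(** Multiplication on the left moves only the row index, so [dom_box] applies column by column. *)
Lemma leading_box_rows (i : 'I_k.-1) M P Q S' : size P = i -> (size P + (size Q).+2)%N = k ->
  leading M (P ++ false :: true :: Q) S' ->
  leading (opmul (T i) M) (P ++ true :: false :: Q) S'.
Proof.
move=> HP Hk [HM1 HM2].
have D y : (forall w, size w = (size P + (size Q).+2)%N -> M (ofw k w) y != 0 ->
    dom w (P ++ false :: true :: Q)).
  by rewrite Hk => w Hw /HM1 []; rewrite ofwK.
split=> [x y|]; rewrite mul_T_rows -HP.
  move=> H; split; first by apply: (dom_box th qh (D y)).1 H; rewrite size_wd.
  case: (pickP (fun z => M z y != 0)) => [z /HM1 [] //|H0].
  move: H; rewrite tlop0 ?eqxx // => v _ _; exact/eqP/negbFE/H0.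
by rewrite ofwK ?size_cat // (dom_box th qh (D _)).2 !mulf_neq0.
Qed.

Lemma leading_box_cols (i : 'I_k.-1) M P Q S : size P = i -> (size P + (size Q).+2)%N = k ->
  leading M S (P ++ false :: true :: Q) ->
  leading (opmul M (T i)) S (P ++ true :: false :: Q).
Proof.
move=> HP Hk [HM1 HM2].
have D x : (forall w, size w = (size P + (size Q).+2)%N -> M x (ofw k w) != 0 ->
    dom w (P ++ false :: true :: Q)).
  by rewrite Hk => w Hw /HM1 []; rewrite ofwK.
split=> [x y|]; rewrite mul_T_cols -HP.
  move=> H; split; last by apply: (dom_box th' qh (D x)).1 H; rewrite size_wd.
  case: (pickP (fun z => M x z != 0)) => [z /HM1 [] //|H0].
  move: H; rewrite tlop0 ?eqxx // => v _ _; exact/eqP/negbFE/H0.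
by rewrite [X in tlop _ _ _ _ X]ofwK ?size_cat // (dom_box th' qh (D _)).2 !mulf_neq0.
Qed.

Lemma map_val_of_letters (u : seq nat) :
  all (fun i => i < k.-1)%N u -> map val (of_letters k u) = u.
Proof.
elim: u => //= i u IH /andP[Hi /IH E].
by rewrite /of_letters /= insubT /= -/(of_letters k u) E.
Qed.

Lemma leading_rep_rows h u S S' w : (h.*2 <= k.-1.+1)%N -> rep k.-1 h u S ->
  leading (evword T (of_letters k w)) (zigzag h (k.-1.+1 - h.*2)) S' ->
  leading (evword T (of_letters k (u ++ w))) S S'.
Proof.
move=> hm H HL; elim: H => [//|{}u P Q Hu IH].
have Hs := rep_size hm Hu; rewrite size_cat prednK //= in Hs.
have Hi : (size P < k.-1)%N by move: Hs; clear; lia.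
rewrite cat_cons -cat1s of_letters_cat of_letters1.
exact: leading_box_rows.
Qed.

Lemma leading_rep_cols h v S S' w : (h.*2 <= k.-1.+1)%N -> rep k.-1 h v S' ->
  leading (evword T (of_letters k w)) S (zigzag h (k.-1.+1 - h.*2)) ->
  leading (evword T (of_letters k (w ++ rev v))) S S'.
Proof.
move=> hm H HL; elim: H => [|{}v P Q Hv IH]; first by rewrite cats0.
have Hs := rep_size hm Hv; rewrite size_cat prednK //= in Hs.
have Hi : (size P < k.-1)%N by move: Hs; clear; lia.
rewrite rev_cons -cats1 catA of_letters_cat of_letters1 cats1.
apply: (leading_ext (M := opmul (evword T (of_letters k (w ++ rev v))) (T (Ordinal Hi)))).
  by move=> x y; rewrite evword_rcons.
exact: leading_box_cols.
Qed.

Lemma leading_cups h : (h.*2 <= k)%N ->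
  leading (evword T (of_letters k (cups h)))
    (zigzag h (k.-1.+1 - h.*2)) (zigzag h (k.-1.+1 - h.*2)).
Proof.
move=> hk; rewrite prednK //.
have Hv : map val (of_letters k (cups h)) = cups h.
  by apply: map_val_of_letters; apply: sub_all (cups_bound h) => j; move: hk; clear; lia.
have Hz : size (zigzag h (k - h.*2)) = k by rewrite size_zigzag subnKC.
split=> [x y|]; rewrite evword_rows Hv; last by rewrite !ofwK // cups_diag.
by apply: dom_cups; rewrite size_wd subnKC.
Qed.

Lemma ups_downs (w : seq bool) : (ups w + count negb w)%N = size w.
Proof. exact: count_predC. Qed.

Lemma ballot_downs x : ballot 0 (wd x) -> ((count negb (wd x)).*2 <= k)%N.
Proof. by move/ballot_size; have := ups_downs (wd x); rewrite size_wd; clear; lia. Qed.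

Theorem TL_iso_tensor_power : TL_iso xi G T.
Proof.
have Ek : k.-1.+1 = k by exact: prednK.
(* One box word is fixed for each ballot word; by [rep_uniq] the choice is immaterial modulo the
   relations. *)
have [nf Hnf] : exists nf : tpb 2 k -> seq nat, forall x, ballot 0 (wd x) ->
    rep k.-1 (count negb (wd x)) (nf x) (wd x).
  apply: (@fin_all_exists _ (fun _ => seq nat)
    (fun x u => ballot 0 (wd x) -> rep k.-1 (count negb (wd x)) u (wd x))) => x.
  case: (boolP (ballot 0 (wd x))) => [Hb|_]; last by exists [::].
  have [|u Hu] := @rep_exists k.-1 (wd x) _ Hb; first by rewrite size_wd.
  by exists u.
pose letters (I : tpb 2 k * tpb 2 k) :=
  nf I.1 ++ cups (count negb (wd I.1)) ++ rev (nf I.2).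
pose nfw I := of_letters k (letters I).
pose E I (J : tpb 2 k * tpb 2 k) := evword T (nfw I) J.1 J.2.
pose good := same_weight_ballots.
have downs I : good I -> count negb (wd I.2) = count negb (wd I.1).
  case/and3P => _ _ /eqP Hu.
  apply: (@addnI (ups (wd I.2))); rewrite -{2}Hu.
  by rewrite !ups_downs !size_wd.
have lead I : good I -> leading (evword T (nfw I)) (wd I.1) (wd I.2).
  move=> HI; have /and3P[Hb1 Hb2 _] := HI; have Hk := ballot_downs Hb1.
  rewrite /nfw /letters; apply: leading_rep_rows (Hnf _ Hb1) _; first by rewrite Ek.
  apply: (@leading_rep_cols (count negb (wd I.1))); first by rewrite Ek.
    by rewrite -downs //; exact: Hnf.
  exact: leading_cups.
have E_diag I : good I -> E I I != 0.
  by move/lead => [_]; rewrite !wdK.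
pose rk (I : tpb 2 k * tpb 2 k) := (prefix_weight (wd I.1) + prefix_weight (wd I.2))%N.
have E_tri I J : good I -> E I J != 0 -> I = J \/ (rk J < rk I)%N.
  case: I J => [x y] [x' y'] /lead [H _] /H /= [/dom_lt Hx /dom_lt Hy].
  rewrite /rk /=; case: Hx => [/(can_inj (@wdK _)) ->|Hx]; last first.
    right; case: Hy => [->|Hy]; first by rewrite ltn_add2r.
    by rewrite -addSn leq_add // ltnW.
  case: Hy => [/(can_inj (@wdK _)) ->|Hy]; first by left.
  by right; rewrite ltn_add2l.
have span (w : word k) : exists c I, good I /\ tlred xi k.-1 (map val w) c (letters I).
  have Hw : all (fun i => i < k.-1)%N (map val w).
    by apply/allP => _ /mapP[i _ ->]; exact: ltn_ord.
  have [c [h [u [S [v [S' [hm Hu Hv Hc]]]]]]] := rep_span xi Hw.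
  have HS := rep_size hm Hu; have HS' := rep_size hm Hv; rewrite Ek in HS HS'.
  have Hd := rep_downs Hu; have Hd' := rep_downs Hv.
  have HI : good (ofw k S, ofw k S').
    rewrite /good /same_weight_ballots /= !ofwK // (rep_ballot Hu) (rep_ballot Hv) /=.
    by rewrite -(eqn_add2r h) -{1}Hd -Hd' !ups_downs HS HS'.
  exists c, (ofw k S, ofw k S'); split=> //; rewrite /letters /= ofwK // Hd.
  have /and3P[/Hnf H1 /Hnf H2 _] := HI; rewrite !ofwK // ?Hd ?Hd' in H1 H2.
  apply: tlred_teq Hc _.
  apply: teq_trans (tlred_catr _ (rep_uniq xi hm Hu H1)) _.
  by apply: tlred_catl; apply: tlred_catl; apply: tlred_rev; exact: rep_uniq Hv H2.
have coef_nf (F : tpb 2 k * tpb 2 k -> K) (w : word k) :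
    coef [seq (F B, nfw B) | B <- enum good] w = \sum_(I | good I) (if nfw I == w then F I else 0).
  by rewrite /coef big_map big_enum.
(* The same coefficients C must serve both in the algebra and for the operators, so both claims are
   proved in one induction. *)
have expand (p : ncpoly K k) : exists C : tpb 2 k * tpb 2 k -> K,
    in_TLideal xi (p ++ [seq (- C B, nfw B) | B <- enum good]) /\
    forall x y, evpoly T p x y = \sum_(I | good I) C I * E I (x, y).
  elim: p => [|[a w] p [C [HC1 HC2]]].
    exists (fun=> 0); split=> [|x y].
      apply: ideal_ext (ideal_nil _ xi) => z; rewrite coef_nil coef_nf.
      by rewrite big1 // => I _; rewrite oppr0 if_same.
    by rewrite /evpoly big_nil big1 // => I _; rewrite mul0r.
  have [c [I [HI Hc]]] := span w.
  (* The new term a w is congruent to a c times the normal word of I. *)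
  exists (fun J => C J + (I == J)%:R * (a * c)); split=> [|x y].
    have := ideal_sandwich a [::] [::] (tlred_ideal Hc).
    rewrite of_lettersK => H; apply: ideal_ext (ideal_cat HC1 H) => z.
    rewrite /sandwich /= !cats0 !(coef_cat, coef_cons) coef_nil !coef_nf -/(nfw I).
    rewrite [in RHS](eq_bigr (fun J => (if nfw J == z then - C J else 0)
       + (I == J)%:R * (if nfw J == z then - (a * c) else 0))) => [|J _]; last first.
      by case: ifP => _; ring.
    rewrite big_split /= [X in _ = _ + (_ + (_ + X))](bigD1 I) //=.
    rewrite [X in _ = _ + (_ + (_ + (_ + X)))]big1 => [|J /andP[_ HJ]]; last first.
      by rewrite eq_sym (negbTE HJ) mul0r.
    by rewrite eqxx; case: (w == z); case: (nfw I == z); rewrite /=; ring.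
  rewrite /evpoly big_cons -/(evpoly T p x y) HC2 /=.
  rewrite [RHS](eq_bigr (fun J => C J * E J (x, y) + (I == J)%:R * (a * c * E J (x, y)))) => [|J _]; last by ring.
  rewrite big_split /= [X in _ = _ + X](bigD1 I) //= [X in _ = _ + (_ + X)]big1 => [|J /andP[_ HJ]]; last first.
    by rewrite eq_sym (negbTE HJ) mul0r.
  have Hl : map val (nfw I) = letters I.
    apply: map_val_of_letters; rewrite -(tlred_all Hc).
    by apply/allP => _ /mapP[i _ ->]; exact: ltn_ord.
  rewrite -Hl in Hc; rewrite (tlred_evword x y Hc) eqxx /E /=; ring.
split.
- exact: T_commutant.
- by move=> p Hp x y; exact: T_relator.
- move=> M HM.
  (* A combination of normal words is fitted to M at the pairs of ballot words; the difference lies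
     in the commutant and vanishes at these pairs, hence everywhere. *)
  have [c Hc] := triangular_solve E_diag E_tri (fun I => M I.1 I.2).
  pose p : ncpoly K k := [seq (c B, nfw B) | B <- enum good].
  exists p => x y; apply/eqP; rewrite eq_sym -subr_eq0; apply/eqP; move: x y.
  apply: (commutant_zero (M := fun x y => M x y - evpoly T p x y)).
    apply: commutant_sub => //; apply: commutant_evpoly; exact: T_commutant.
  move=> x y Hxy; rewrite -(Hc _ Hxy) /evpoly /p big_map big_enum /=.
  exact: subrr.
(* Since p acts by 0, triangularity forces C = 0, and then the membership given by [expand] concerns
   p itself. *)
- move=> p Hp; have [C [HC1 HC2]] := expand p.
  have C0 : forall I, good I -> C I = 0.
    apply: (triangular_free E_diag E_tri) => -[x y] _.
    by rewrite -HC2.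
  apply: ideal_ext HC1 => z; rewrite coef_cat coef_nf big1 ?addr0 // => I /C0 ->.
  by rewrite oppr0 if_same.
Qed.

End Main.

Unset Implicit Arguments.

Theorem mainTheorem12 (K : closedFieldType) (charK0 : [pchar K] =i pred0)
  (n : nat) (Hn : (2 <= n)%N) (q : K) (Hq : n.-primitive_root q)
  (qh : K) (Hqh : qh ^+ 2 = q) (r : 'I_n)
  (k : nat) (Hk1 : (1 <= k)%N) (Hk2 : (k <= 2 * n - 2)%N) :
  let act := Vact q 2 (r : nat)%:Z in
  let lam := q ^ (- ((r : nat) * (r : nat).+1)%:Z) in
  let xi := - (qh + qh^-1) in
  TL_iso xi (@rho K 2 act k) (@piT K q n 2 k act qh lam).
Proof.
move=> act lam xi; apply: TL_iso_tensor_power => //.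
by rewrite ((pcharf0P K).1 charK0) -lt0n ltnW.
Qed.
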